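(* Let $G$ be a classical complex Lie group with complex simple Lie algebra $\mathfrak g$, let $\mathbb C(G)$ be its coordinate Hopf algebra, and let $\mathbb C_q(G)$ be the associated standard quantum group (over $\mathbb C[[\hbar]]$, $q=e^{\hbar/2}$), obtained as $\mathbb C_q(G)\cong(\mathbb C(G)[[\hbar]])^F$ for a cochain $F$ and viewed as the cotriangular coquasi-Hopf algebra $(\mathbb C_q(G),\mathcal R_F,\phi_{KZ})$. Let $M$ be a classical $G$-manifold in the algebraic sense that there is a coordinate algebra $\mathbb C(M)$ and a coaction $\mathbb C(M)\to\mathbb C(G)\otimes\mathbb C(M)$ making $\mathbb C(M)$ an algebra in the category of $\mathbb C(G)$-comodules, with classical differential calculus $\Omega(\mathbb C(M))$. Then there is a quasialgebra $\mathcal C_q(M)=(\mathbb C(M)[[\hbar]])_F$ in the category of $\mathbb C_q(G)$-comodules. Moreover, $\mathcal C_q(M)$ has a quasiassociative differential calculus $\Omega(\mathbb C(M))_F$ (extended over $\mathbb C[[\hbar]]$).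
   Context: All data are extended over $\mathbb C[[\hbar]]$ (with tensor products understood in the formal power series sense). Sweedler notation is used for coproducts and left coactions $a\mapsto a_{(1)}\otimes a_{(2)}$. Let $H=\mathbb C(G)[[\hbar]]$ with its classical Hopf algebra structure, trivial associator and trivial coquasitriangular structure. A cochain is a convolution invertible map $F:H\otimes H\to\mathbb C[[\hbar]]$ with $F(a,1)=F(1,a)=\epsilon(a)$. The cotwist $H^F$ is the coalgebra $H$ with product $a*b=F(a_{(1)},b_{(1)})a_{(2)}b_{(2)}F^{-1}(a_{(3)},b_{(3)})$, associator $\phi_F(a,b,c)=F(b_{(1)},c_{(1)})F(a_{(1)},b_{(2)}c_{(2)})F^{-1}(a_{(2)}b_{(3)},c_{(3)})F^{-1}(a_{(3)},b_{(4)})$ and cotriangular structure $\mathcal R_F(a,b)=F(b_{(1)},a_{(1)})F^{-1}(a_{(2)},b_{(2)})$. It is known (dualising Drinfeld) that there is a cochain $F$ with $\mathbb C_q(G)\cong H^F$, where $\mathbb C_q(G)$ is the formal power series version of the standard quantum group coordinate algebra (dual to the Drinfeld–Jimbo quantum enveloping algebra of $\mathfrak g$); such an $F$ is fixed, and $\phi_{KZ}:=\phi_F$. The category of left $\mathbb C_q(G)$-comodules is monoidal with associator $u\otimes(v\otimes w)\mapsto\phi_{KZ}(u_{(1)},v_{(1)},w_{(1)})(u_{(2)}\otimes v_{(2)})\otimes w_{(2)}$ and has symmetric braiding $u\otimes v\mapsto\mathcal R_F(v_{(1)},u_{(1)})v_{(2)}\otimes u_{(2)}$. A quasialgebra in it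 is an algebra in this category: a comodule $B$ with a unital product which is a comodule map ($(a\cdot b)_{(1)}\otimes(a\cdot b)_{(2)}=a_{(1)}*b_{(1)}\otimes a_{(2)}\cdot b_{(2)}$) and obeys $a\cdot(b\cdot c)=\phi_{KZ}(a_{(1)},b_{(1)},c_{(1)})(a_{(2)}\cdot b_{(2)})\cdot c_{(2)}$. For an algebra $A$ in the category of $H$-comodules, $A_F$ denotes the same comodule with product $a\cdot b=F(a_{(1)},b_{(1)})a_{(2)}b_{(2)}$. Likewise, for the ($G$-covariant) classical differential graded algebra $\Omega(\mathbb C(M))$, $\Omega(\mathbb C(M))_F$ has the same forms, coaction and differential $d$, with product $\omega\cdot\omega'=F(\omega_{(1)},\omega'_{(1)})\omega_{(2)}\omega'_{(2)}$. A quasiassociative differential calculus on $B$ is a graded object $\Omega=\bigoplus_k\Omega_k$ in the comodule category with $\Omega_0=B$, a product extending that of $B$ by comodule maps $\Omega_i\otimes\Omega_j\to\Omega_{i+j}$, unital and associative up to $\phi_{KZ}$ as in $\omega\cdot(\omega'\cdot\omega'')=\phi_{KZ}(\omega_{(1)},\omega'_{(1)},\omega''_{(1)})(\omega_{(2)}\cdot\omega'_{(2)})\cdot\omega''_{(2)}$, and comodule maps $d:\Omega_k\to\Omega_{k+1}$ with $d^2=0$, the graded Leibniz rule $d(\omega\cdot\omega')=d\omega\cdot\omega'+(-1)^{|\omega|}\omega\cdot d\omega'$, and $B\otimes\Omega_{k-1}\to\Omega_k$, $b\otimes\omega\mapsto b\cdot d\omega$, an epimorphism for each $k\geq 1$.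 *)

(* Defs.v *)
From HB Require Import structures.
From mathcomp Require Import all_boot all_order all_algebra generic_quotient.
From mathcomp Require Import boolp reals complex.

Set Implicit Arguments.
Unset Strict Implicit.
Unset Printing Implicit Defensive.

Import Order.TTheory GRing.Theory Num.Theory.
Local Open Scope quotient_scope.
Local Open Scope ring_scope.

Definition bilin (K : pzRingType) (U V W : lmodType K) (f : U -> V -> W) : Prop :=
  (forall u, linear (f u)) /\ (forall v, linear (f^~ v)).

Section TensorProduct.
Variables (K : comNzRingType) (V W : lmodType K).
Implicit Types (s t : seq (V * W)).

(* The list s stands for the sum of the x.1 (x) x.2, x in s; two lists are
   identified when no bilinear map distinguishes them. This makes the universal
   property (tlift below) hold by construction. *)
Definition tens_eq s t : bool :=
  `[< forall (X : lmodType K) (f : V -> W -> X), bilin f ->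
      \sum_(x <- s) f x.1 x.2 = \sum_(x <- t) f x.1 x.2 >].

Lemma tens_eq_equiv : equiv_class_of tens_eq.
Proof.
split=> [s|s t|s t u].
- exact/asboolP.
- by apply/asboolP/asboolP => E X f bf; rewrite E.
- by move=> /asboolP E1 /asboolP E2; apply/asboolP => X f bf; rewrite E1 ?E2.
Qed.

Canonical tens_eq_equiv_rel := EquivRelPack tens_eq_equiv.

Definition tens : Type := {eq_quot tens_eq}%qT.
HB.instance Definition _ := EqQuotient.on tens.
HB.instance Definition _ := Choice.on tens.

Definition tsum s : tens := \pi_tens s.
Definition tpure (v : V) (w : W) : tens := tsum [:: (v, w)].
Definition tscale_seq (c : K) s := [seq (c *: x.1, x.2) | x <- s].
Definition tzero : tens := tsum [::].
Definition tadd (x y : tens) := tsum (repr x ++ repr y).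
Definition tscale c (x : tens) := tsum (tscale_seq c (repr x)).
Definition topp (x : tens) := tscale (-1) x.

Definition teval (X : lmodType K) (f : V -> W -> X) s := \sum_(x <- s) f x.1 x.2.

Lemma tens_ext (x y : tens) :
  (forall (X : lmodType K) (f : V -> W -> X), bilin f ->
     teval f (repr x) = teval f (repr y)) -> x = y.
Proof.
by move=> E; rewrite -[x]reprK -[y]reprK; apply/eqmodP/asboolP.
Qed.

Lemma teval_tsum (X : lmodType K) (f : V -> W -> X) s : bilin f ->
  teval f (repr (tsum s)) = teval f s.
Proof.
move=> bf; have /eqmodP/asboolP E : repr (tsum s) = s %[mod tens] by rewrite reprK.
exact: E.
Qed.

Lemma teval_cat (X : lmodType K) (f : V -> W -> X) s t :
  teval f (s ++ t) = teval f s + teval f t.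
Proof. exact: big_cat. Qed.

Lemma bilinZl (X : lmodType K) (f : V -> W -> X) c v w : bilin f ->
  f (c *: v) w = c *: f v w.
Proof.
case=> _ fl; have fl0 : f 0 w = 0.
  have := fl w 1 0 0; rewrite !scale1r add0r => E.
  by apply: (addIr (f 0 w)); rewrite -E add0r.
by have := fl w c v 0; rewrite addr0 fl0 addr0.
Qed.

Lemma teval_scale (X : lmodType K) (f : V -> W -> X) c s : bilin f ->
  teval f (tscale_seq c s) = c *: teval f s.
Proof.
move=> bf; rewrite /teval big_map scaler_sumr.
by apply: eq_bigr => x _; rewrite bilinZl.
Qed.

Lemma tens_addA : associative tadd.
Proof.
move=> x y z; apply: tens_ext => X f bf.
by rewrite !(teval_tsum, teval_cat) // addrA.
Qed.

Lemma tens_addC : commutative tadd.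
Proof.
by move=> x y; apply: tens_ext => X f bf; rewrite !(teval_tsum, teval_cat) // addrC.
Qed.

Lemma tens_add0 : left_id tzero tadd.
Proof.
move=> x; apply: tens_ext => X f bf; rewrite !(teval_tsum, teval_cat) //.
by rewrite {1}/teval big_nil add0r.
Qed.

Lemma tens_addN : left_inverse tzero topp tadd.
Proof.
move=> x; apply: tens_ext => X f bf.
rewrite !(teval_tsum, teval_cat, teval_scale) //.
by rewrite scaleN1r addNr /teval big_nil.
Qed.

HB.instance Definition _ :=
  GRing.isZmodule.Build tens tens_addA tens_addC tens_add0 tens_addN.

Lemma tens_scaleA a b x : tscale a (tscale b x) = tscale (a * b) x.
Proof.
apply: tens_ext => X f bf; rewrite !(teval_tsum, teval_scale) //.
by rewrite scalerA.
Qed.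

Lemma tens_scale1 : left_id 1 tscale.
Proof.
by move=> x; apply: tens_ext => X f bf; rewrite !(teval_tsum, teval_scale) // scale1r.
Qed.

Lemma tens_scaleDr : right_distributive tscale +%R.
Proof.
move=> c x y; apply: tens_ext => X f bf.
by rewrite !(teval_tsum, teval_cat, teval_scale) // scalerDr.
Qed.

Lemma tens_scaleDl x : {morph tscale^~ x : a b / a + b}.
Proof.
move=> a b; apply: tens_ext => X f bf.
by rewrite !(teval_tsum, teval_cat, teval_scale) // scalerDl.
Qed.

HB.instance Definition _ := GRing.Zmodule_isLmodule.Build K tens
  tens_scaleA tens_scale1 tens_scaleDr tens_scaleDl.

Definition tlift (X : lmodType K) (f : V -> W -> X) (t : tens) : X :=
  teval f (repr t).

Lemma tlift_pure (X : lmodType K) (f : V -> W -> X) v w : bilin f ->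
  tlift f (tpure v w) = f v w.
Proof. by move=> bf; rewrite /tlift teval_tsum // /teval big_seq1. Qed.

Lemma tlift_linear (X : lmodType K) (f : V -> W -> X) : bilin f -> linear (tlift f).
Proof.
move=> bf c x y; rewrite /tlift.
by rewrite [c *: x + y]/(tadd (tscale c x) y) !(teval_tsum, teval_cat, teval_scale).
Qed.

Lemma tpure_bilin : bilin tpure.
Proof.
split=> [v c w1 w2|w c v1 v2]; apply: tens_ext => X f bf;
  rewrite -!/(tlift f _) tlift_linear // !tlift_pure //.
- exact: (proj1 bf).
- exact: (proj2 bf).
Qed.

Lemma tens_sum_repr (t : tens) : t = \sum_(x <- repr t) tpure x.1 x.2.
Proof.
apply: tens_ext => X f bf; rewrite -!/(tlift f _).
have tliftD : {morph tlift f : x y / x + y}.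
  by move=> x y; have := tlift_linear bf 1 x y; rewrite !scale1r.
have tlift0 : tlift f 0 = 0 by apply: (addIr (tlift f 0)); rewrite -tliftD !add0r.
rewrite (big_morph _ tliftD tlift0); apply: eq_bigr => x _.
by rewrite tlift_pure.
Qed.

End TensorProduct.

Arguments tpure {K V W} v w.

(* Sweedler notation over the base ring: sum over a decomposition of t into
   pure tensors x (x) y; independent of the decomposition when e is bilinear
   in (x, y). *)
Reserved Notation "\csw_ ( x , y <- t ) e"
  (at level 36, x name, y name, t at level 100, e at level 36,
   format "\csw_ ( x ,  y  <-  t )  e").
Notation "\csw_ ( x , y <- t ) e" :=
  (\sum_(p <- repr t) (fun x y => e) p.1 p.2) : ring_scope.

(* V[[h]], the formal power series in h with coefficients in V. *)
Record fps (V : Type) : Type := Fps { coefh :> nat -> V }.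

Section FpsZmod.
Variable V : zmodType.
Implicit Types u v w : fps V.

Lemma fpsP (u v : fps V) : u =1 v <-> u = v.
Proof. by case: u => u; case: v => v; split=> [/funext /= ->|->]. Qed.

HB.instance Definition _ := gen_eqMixin (fps V).
HB.instance Definition _ := gen_choiceMixin (fps V).

Definition fps_zero := Fps (fun _ => 0 : V).
Definition fps_add u v := Fps (fun n => u n + v n).
Definition fps_opp u := Fps (fun n => - u n).

Lemma fps_addA : associative fps_add.
Proof. by move=> u v w; apply/fpsP => n /=; rewrite addrA. Qed.
Lemma fps_addC : commutative fps_add.
Proof. by move=> u v; apply/fpsP => n /=; rewrite addrC. Qed.
Lemma fps_add0 : left_id fps_zero fps_add.
Proof. by move=> u; apply/fpsP => n /=; rewrite add0r. Qed.
Lemma fps_addN : left_inverse fps_zero fps_opp fps_add.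
Proof. by move=> u; apply/fpsP => n /=; rewrite addNr. Qed.

HB.instance Definition _ :=
  GRing.isZmodule.Build (fps V) fps_addA fps_addC fps_add0 fps_addN.

Lemma coefhD u v n : (u + v) n = u n + v n. Proof. by []. Qed.
Lemma coefh0 n : (0 : fps V) n = 0. Proof. by []. Qed.

Definition hconst (v : V) : fps V := Fps (fun n => if n is 0%N then v else 0).

Definition hsum (u : nat -> fps V) : fps V :=
  Fps (fun n => \sum_(i < n.+1) u i (n - i)%N).

End FpsZmod.

Definition hmap (V W : Type) (f : V -> W) (u : fps V) : fps W :=
  Fps (fun n => f (u n)).

Definition hmap2 (V W : Type) (X : zmodType) (f : V -> W -> X)
    (u : fps V) (v : fps W) : fps X :=
  Fps (fun n => \sum_(i < n.+1) f (u i) (v (n - i)%N)).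

Lemma hmap2A (V W X : Type) (Y Z T : zmodType) (f : V -> W -> Y) (f' : Y -> X -> T)
    (g : W -> X -> Z) (g' : V -> Z -> T) u v w :
  (forall x, {morph f'^~ x : a b / a + b}) -> (forall x, f' 0 x = 0) ->
  (forall x, {morph g' x : a b / a + b}) -> (forall x, g' x 0 = 0) ->
  (forall a b c, g' a (g b c) = f' (f a b) c) ->
  hmap2 g' u (hmap2 g v w) = hmap2 f' (hmap2 f u v) w.
Proof.
move=> f'D f'0 g'D g'0 A; apply/fpsP => i /=.
have g'S a n (F : 'I_n -> Z) : g' a (\sum_k F k) = \sum_k g' a (F k).
  exact: (big_morph (g' a) (g'D a) (g'0 a)).
have f'S a n (F : 'I_n -> Y) : f' (\sum_k F k) a = \sum_k f' (F k) a.
  exact: (big_morph (f'^~ a) (f'D a) (f'0 a)).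
pose c3 j k := g' (u j) (g (v (i - j - k)%N) (w k)).
transitivity (\sum_(j < i.+1) \sum_(k < i.+1 | (k <= i - j)%N) c3 j k).
  apply: eq_bigr => /= j _; rewrite g'S (big_ord_narrow_leq (leq_subr _ _)).
  rewrite [LHS](reindex_inj rev_ord_inj) /=; apply: eq_bigr => k _.
  have kl : (k <= i - j)%N by rewrite -ltnS ltn_ord.
  by rewrite /c3 /= subSS subKn.
rewrite (exchange_big_dep predT) //= [LHS](reindex_inj rev_ord_inj) /=.
apply: eq_bigr => k _.
have kl : (k <= i)%N by rewrite -ltnS ltn_ord.
rewrite !subSS.
transitivity (\sum_(j < i.+1 | (j <= k)%N) c3 j (i - k)%N).
  apply: eq_bigl => j; have jl : (j <= i)%N by rewrite -ltnS ltn_ord.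
  by rewrite leq_subLR addnC -leq_subLR subKn // addnC.
rewrite (big_ord_narrow_leq kl) /= f'S.
apply: eq_bigr => j _; rewrite /c3 A.
have jl : (j <= k)%N by rewrite -ltnS ltn_ord.
by rewrite -subnDA addnC subnDA subKn.
Qed.

Section FpsRing.
Variable A : nzRingType.
Implicit Types u v w : fps A.

Definition fps_mul u v : fps A := hmap2 *%R u v.
Definition fps_one : fps A := hconst 1.

Lemma fps_mulA : associative fps_mul.
Proof.
move=> u v w; apply: hmap2A => [x y z|x|x y z|x|a b c].
- exact: mulrDl.
- exact: mul0r.
- exact: mulrDr.
- exact: mulr0.
- exact: mulrA.
Qed.

Lemma fps_mul1 : left_id fps_one fps_mul.
Proof.
move=> u; apply/fpsP => n /=; rewrite big_ord_recl /= mul1r subn0 big1 ?addr0 // => i _.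
by rewrite mul0r.
Qed.

Lemma fps_mulr1 : right_id fps_one fps_mul.
Proof.
move=> u; apply/fpsP => n /=.
rewrite big_ord_recr /= subnn mulr1 big1 ?add0r // => i _.
by rewrite -(subnSK (ltn_ord i)) mulr0.
Qed.

Lemma fps_mulDl : left_distributive fps_mul +%R.
Proof.
move=> u v w; apply/fpsP => n /=; rewrite -big_split /=.
by apply: eq_bigr => i _; rewrite mulrDl.
Qed.

Lemma fps_mulDr : right_distributive fps_mul +%R.
Proof.
move=> u v w; apply/fpsP => n /=; rewrite -big_split /=.
by apply: eq_bigr => i _; rewrite mulrDr.
Qed.

Lemma fps_one_neq0 : fps_one != 0.
Proof.
apply/eqP => /fpsP/(_ 0%N) /= /eqP.
by rewrite (negbTE (oner_neq0 A)).
Qed.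

HB.instance Definition _ := GRing.Zmodule_isNzRing.Build (fps A)
  fps_mulA fps_mul1 fps_mulr1 fps_mulDl fps_mulDr fps_one_neq0.

End FpsRing.

Section FpsComRing.
Variable A : comNzRingType.

Lemma fps_mulC : commutative (@GRing.mul (fps A)).
Proof.
move=> u v; apply/fpsP => n /=; rewrite [LHS](reindex_inj rev_ord_inj) /=.
apply: eq_bigr => i _; have il : (i <= n)%N by rewrite -ltnS ltn_ord.
by rewrite subSS subKn // [RHS](@mulrC A).
Qed.

HB.instance Definition _ := GRing.PzRing_hasCommutativeMul.Build (fps A) fps_mulC.

End FpsComRing.

Section FpsLmod.
Variables (K : comNzRingType) (V : lmodType K).
Implicit Types (a b : fps K) (u v : fps V).

Definition fps_scale a u : fps V := hmap2 *:%R a u.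

Lemma fps_scaleA a b u : fps_scale a (fps_scale b u) = fps_scale (a * b) u.
Proof.
apply: hmap2A => [x y z|x|x y z|x|c d v].
- exact: scalerDl.
- exact: scale0r.
- exact: scalerDr.
- exact: scaler0.
- exact: scalerA.
Qed.

Lemma fps_scale1 : left_id 1 fps_scale.
Proof.
move=> u; apply/fpsP => n /=.
rewrite big_ord_recl /= scale1r subn0 big1 ?addr0 // => i _.
by rewrite scale0r.
Qed.

Lemma fps_scaleDr : right_distributive fps_scale +%R.
Proof.
move=> a u v; apply/fpsP => n /=; rewrite -big_split /=.
by apply: eq_bigr => i _; rewrite scalerDr.
Qed.

Lemma fps_scaleDl u : {morph fps_scale^~ u : a b / a + b}.
Proof.
move=> a b; apply/fpsP => n /=; rewrite -big_split /=.
by apply: eq_bigr => i _; rewrite scalerDl.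
Qed.

HB.instance Definition _ := GRing.Zmodule_isLmodule.Build (fps K) (fps V)
  fps_scaleA fps_scale1 fps_scaleDr fps_scaleDl.

End FpsLmod.

(* The completed tensor product of V[[h]] and W[[h]] over K[[h]] is
   (V (x) W)[[h]], that is fps (tens V W). *)
Definition hpure (K : comNzRingType) (V W : lmodType K) (u : fps V) (v : fps W) :
  fps (tens V W) := hmap2 tpure u v.

(* Sweedler notation over K[[h]]: the value on t, in (V (x) W)[[h]], of the
   map induced by (x, y) |-> e. It is meaningful when e is K[[h]]-bilinear in
   (x, y); such a map is determined by its values on V x W, and K[[h]]-linear
   maps between modules V[[h]] are automatically h-adically continuous. *)
Definition hsweedler (K : comNzRingType) (V W : lmodType K) (X : zmodType)
    (t : fps (tens V W)) (e : fps V -> fps W -> fps X) : fps X :=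
  hsum (fun n => \sum_(p <- repr (t n)) e (hconst p.1) (hconst p.2)).

Reserved Notation "\sw_ ( x , y <- t ) e"
  (at level 36, x name, y name, t at level 100, e at level 36,
   format "\sw_ ( x ,  y  <-  t )  e").
Notation "\sw_ ( x , y <- t ) e" := (hsweedler t (fun x y => e)) : ring_scope.

Record comHopf (K : fieldType) := ComHopf {
  hopf_alg :> comAlgType K;
  cop : hopf_alg -> tens hopf_alg hopf_alg;
  counit : hopf_alg -> K;
  antipode : hopf_alg -> hopf_alg;
  cop_linear : linear cop;
  counit_linear : scalar counit;
  antipode_linear : linear antipode;
  cop_coassoc : forall a,
    \csw_(x, y <- cop a) \csw_(x1, x2 <- cop x) tpure (tpure x1 x2) y =
    \csw_(x, y <- cop a) \csw_(y1, y2 <- cop y) tpure (tpure x y1) y2;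
  cop_counitl : forall a, \csw_(x, y <- cop a) (counit x *: y) = a;
  cop_counitr : forall a, \csw_(x, y <- cop a) (counit y *: x) = a;
  copM : forall a b, cop (a * b) =
    \csw_(a1, a2 <- cop a) \csw_(b1, b2 <- cop b) tpure (a1 * b1) (a2 * b2);
  cop1 : cop 1 = tpure 1 1;
  counitM : forall a b, counit (a * b) = counit a * counit b;
  counit1 : counit 1 = 1;
  antipodel : forall a, \csw_(x, y <- cop a) (antipode x * y) = (counit a)%:A;
  antipoder : forall a, \csw_(x, y <- cop a) (x * antipode y) = (counit a)%:A
}.

Section ClassicalComodules.
Variables (K : fieldType) (A : comHopf K).

Record is_comodule (V : lmodType K) (coact : V -> tens A V) : Prop := {
  coact_linear : linear coact;
  coact_coassoc : forall v,
    \csw_(a, x <- coact v) \csw_(a1, a2 <- cop a) tpure (tpure a1 a2) x =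
    \csw_(a, x <- coact v) \csw_(b, y <- coact x) tpure (tpure a b) y;
  coact_counit : forall v, \csw_(a, x <- coact v) (counit a *: x) = v
}.

Record is_comodule_algebra (B : comAlgType K) (coact : B -> tens A B) : Prop := {
  coalg_comodule : is_comodule coact;
  coalgM : forall b c, coact (b * c) =
    \csw_(b1, b2 <- coact b) \csw_(c1, c2 <- coact c) tpure (b1 * c1) (b2 * c2);
  coalg1 : coact 1 = tpure 1 1
}.

(* Degree 0 is B by computation, so the condition that the degree 0 part of a
   calculus is B needs no identification map. *)
Definition graded (B : lmodType K) (P : nat -> lmodType K) (k : nat) : lmodType K :=
  if k is k'.+1 then P k' else B.

(* Classical G-covariant differential graded algebra of forms over B: graded
   commutative, generated by B and dB. The degree of a product is passed with an
   equation i + j = k, so that associativity needs no transport. *)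
Record is_classical_calculus (B : comAlgType K) (coactB : B -> tens A B)
    (P : nat -> lmodType K) (Om := graded B P)
    (coact : forall k, Om k -> tens A (Om k))
    (wedge : forall {i j k}, (i + j)%N = k -> Om i -> Om j -> Om k)
    (d : forall k, Om k -> Om k.+1) : Prop := {
  ccal_coact0 : forall b : B, coact 0%N b = coactB b;
  ccal_wedge0 : forall (e : (0 + 0)%N = 0%N) (a b : B), wedge e a b = a * b;
  ccal_comodule : forall k, is_comodule (coact k);
  ccal_bilin : forall i j k (e : (i + j)%N = k), bilin (wedge e);
  ccal_coactM : forall i j k (e : (i + j)%N = k) (u : Om i) (v : Om j),
    coact k (wedge e u v) =
    \csw_(a, x <- coact i u) \csw_(b, y <- coact j v) tpure (a * b) (wedge e x y);
  ccal_assoc : forall i j k ij jk n (e1 : (i + j)%N = ij) (e2 : (ij + k)%N = n)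
      (e3 : (j + k)%N = jk) (e4 : (i + jk)%N = n) (u : Om i) (v : Om j) (w : Om k),
    wedge e4 u (wedge e3 v w) = wedge e2 (wedge e1 u v) w;
  ccal_unitl : forall k (e : (0 + k)%N = k) (u : Om k), wedge e (1 : B) u = u;
  ccal_unitr : forall k (e : (k + 0)%N = k) (u : Om k), wedge e u (1 : B) = u;
  ccal_comm : forall i j k (e1 : (i + j)%N = k) (e2 : (j + i)%N = k)
      (u : Om i) (v : Om j), wedge e1 u v = (-1) ^+ (i * j) *: wedge e2 v u;
  ccal_d_linear : forall k, linear (d k);
  ccal_d_coact : forall k (u : Om k),
    coact k.+1 (d k u) = \csw_(a, x <- coact k u) tpure a (d k x);
  ccal_dd : forall k (u : Om k), d k.+1 (d k u) = 0;
  ccal_leibniz : forall i j k (e : (i + j)%N = k) (e1 : (i.+1 + j)%N = k.+1)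
      (e2 : (i + j.+1)%N = k.+1) (u : Om i) (v : Om j),
    d k (wedge e u v) = wedge e1 (d i u) v + (-1) ^+ i *: wedge e2 u (d j v);
  ccal_surj : forall k (e : (0 + k.+1)%N = k.+1) (u : Om k.+1),
    exists t : tens B (Om k), u = \csw_(b, x <- t) wedge e (b : Om 0%N) (d k x)
}.

End ClassicalComodules.

(* Only the structure maps over K[[h]]; the notions of comodule, quasialgebra and
   calculus below use nothing else. *)
Record coquasi (K : fieldType) := Coquasi {
  cq_space : lmodType K;
  cq_cop : fps cq_space -> fps (tens cq_space cq_space);
  cq_counit : fps cq_space -> fps K;
  cq_mul : fps cq_space -> fps cq_space -> fps cq_space;
  cq_one : fps cq_space;
  cq_phi : fps cq_space -> fps cq_space -> fps cq_space -> fps K;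
  cq_R : fps cq_space -> fps cq_space -> fps K
}.

Section Cotwist.
Variables (K : fieldType) (A : comHopf K).
Local Notation H := (fps A).
Local Notation Dlt := (hmap (@cop K A)).
Local Notation eps := (hmap (@counit K A)).

Definition is_form (F : H -> H -> fps K) : Prop :=
  (forall a, scalar (F a)) /\ (forall b, scalar (F^~ b)).

Definition conv_inverse (F Fi : H -> H -> fps K) : Prop := forall a b,
  \sw_(a1, a2 <- Dlt a) \sw_(b1, b2 <- Dlt b) (F a1 b1 * Fi a2 b2) = eps a * eps b.

Record is_cochain (F Fi : H -> H -> fps K) : Prop := {
  cochain_form : is_form F;
  cochain_inv_form : is_form Fi;
  cochain_invr : conv_inverse F Fi;
  cochain_invl : conv_inverse Fi F;
  cochain_unitr : forall a, F a 1 = eps a;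
  cochain_unitl : forall a, F 1 a = eps a
}.

Variables F Fi : H -> H -> fps K.

Definition cotwist_mul (a b : H) : H :=
  \sw_(a1, a' <- Dlt a) \sw_(a2, a3 <- Dlt a')
  \sw_(b1, b' <- Dlt b) \sw_(b2, b3 <- Dlt b')
    ((F a1 b1 * Fi a3 b3) *: (a2 * b2)).

Definition cotwist_phi (a b c : H) : fps K :=
  \sw_(a1, a' <- Dlt a) \sw_(a2, a3 <- Dlt a')
  \sw_(b1, b' <- Dlt b) \sw_(b2, b'' <- Dlt b') \sw_(b3, b4 <- Dlt b'')
  \sw_(c1, c' <- Dlt c) \sw_(c2, c3 <- Dlt c')
    (F b1 c1 * F a1 (b2 * c2) * Fi (a2 * b3) c3 * Fi a3 b4).

Definition cotwist_R (a b : H) : fps K :=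
  \sw_(a1, a2 <- Dlt a) \sw_(b1, b2 <- Dlt b) (F b1 a1 * Fi a2 b2).

Definition cotwist : coquasi K :=
  @Coquasi K A Dlt eps cotwist_mul 1 cotwist_phi cotwist_R.

(* coU, coV and m are undeformed, over K; they are extended to power series in
   h coefficientwise. *)
Definition twist_mul (U V W : lmodType K) (coU : U -> tens A U) (coV : V -> tens A V)
    (m : U -> V -> W) (u : fps U) (v : fps V) : fps W :=
  \sw_(a, x <- hmap coU u) \sw_(b, y <- hmap coV v) (F a b *: hmap2 m x y).

End Cotwist.

Section QuasiAlgebras.
Variables (K : fieldType) (Q : coquasi K).
Local Notation A := (cq_space Q).

Record is_hcomodule (V : lmodType K) (coact : fps V -> fps (tens A V)) : Prop := {
  hcoact_linear : linear coact;
  hcoact_coassoc : forall v,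
    \sw_(a, x <- coact v) \sw_(a1, a2 <- cq_cop a) hpure (hpure a1 a2) x =
    \sw_(a, x <- coact v) \sw_(b, y <- coact x) hpure (hpure a b) y;
  hcoact_counit : forall v, \sw_(a, x <- coact v) (cq_counit a *: x) = v
}.

Definition is_hcomodule_map (V W : lmodType K) (coV : fps V -> fps (tens A V))
    (coW : fps W -> fps (tens A W)) (f : fps V -> fps W) : Prop :=
  linear f /\ forall v, coW (f v) = \sw_(a, x <- coV v) hpure a (f x).

Definition is_hcomodule_map2 (U V W : lmodType K) (coU : fps U -> fps (tens A U))
    (coV : fps V -> fps (tens A V)) (coW : fps W -> fps (tens A W))
    (m : fps U -> fps V -> fps W) : Prop :=
  bilin m /\ forall u v, coW (m u v) =
    \sw_(a, x <- coU u) \sw_(b, y <- coV v) hpure (cq_mul a b) (m x y).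

Record is_quasialgebra (B : lmodType K) (coact : fps B -> fps (tens A B))
    (one : fps B) (mul : fps B -> fps B -> fps B) : Prop := {
  qalg_comodule : is_hcomodule coact;
  qalg_mul : is_hcomodule_map2 coact coact coact mul;
  qalg_one : coact one = hpure (cq_one Q) one;
  qalg_unitl : forall b, mul one b = b;
  qalg_unitr : forall b, mul b one = b;
  qalg_assoc : forall a b c, mul a (mul b c) =
    \sw_(a1, a2 <- coact a) \sw_(b1, b2 <- coact b) \sw_(c1, c2 <- coact c)
      (cq_phi a1 b1 c1 *: mul (mul a2 b2) c2)
}.

Record is_quasi_calculus (B : lmodType K) (coactB : fps B -> fps (tens A B))
    (one : fps B) (mulB : fps B -> fps B -> fps B)
    (P : nat -> lmodType K) (Om := graded B P)
    (coact : forall k, fps (Om k) -> fps (tens A (Om k)))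
    (mul : forall {i j k}, (i + j)%N = k -> fps (Om i) -> fps (Om j) -> fps (Om k))
    (d : forall k, fps (Om k) -> fps (Om k.+1)) : Prop := {
  qcal_coact0 : forall b : fps B, coact 0%N b = coactB b;
  qcal_mul0 : forall (e : (0 + 0)%N = 0%N) (a b : fps B), mul e a b = mulB a b;
  qcal_comodule : forall k, is_hcomodule (coact k);
  qcal_mul : forall i j k (e : (i + j)%N = k),
    is_hcomodule_map2 (coact i) (coact j) (coact k) (mul e);
  qcal_unitl : forall k (e : (0 + k)%N = k) (u : fps (Om k)), mul e (one : fps (Om 0%N)) u = u;
  qcal_unitr : forall k (e : (k + 0)%N = k) (u : fps (Om k)), mul e u (one : fps (Om 0%N)) = u;
  qcal_assoc : forall i j k ij jk n (e1 : (i + j)%N = ij) (e2 : (ij + k)%N = n)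
      (e3 : (j + k)%N = jk) (e4 : (i + jk)%N = n)
      (u : fps (Om i)) (v : fps (Om j)) (w : fps (Om k)),
    mul e4 u (mul e3 v w) =
    \sw_(u1, u2 <- coact i u) \sw_(v1, v2 <- coact j v) \sw_(w1, w2 <- coact k w)
      (cq_phi u1 v1 w1 *: mul e2 (mul e1 u2 v2) w2);
  qcal_d : forall k, is_hcomodule_map (coact k) (coact k.+1) (d k);
  qcal_dd : forall k (u : fps (Om k)), d k.+1 (d k u) = 0;
  qcal_leibniz : forall i j k (e : (i + j)%N = k) (e1 : (i.+1 + j)%N = k.+1)
      (e2 : (i + j.+1)%N = k.+1) (u : fps (Om i)) (v : fps (Om j)),
    d k (mul e u v) = mul e1 (d i u) v + (-1) ^+ i *: mul e2 u (d j v);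
  qcal_surj : forall k (e : (0 + k.+1)%N = k.+1) (u : fps (Om k.+1)),
    exists t : fps (tens B (Om k)),
      u = \sw_(b, x <- t) mul e (b : fps (Om 0%N)) (d k x)
}.

End QuasiAlgebras.

Section MatrixGroups.
Variables (K : fieldType) (n : nat).

(* Regular functions on GL_n, extended by junk values to singular matrices. *)
Inductive regular : ('M[K]_n -> K) -> Prop :=
| regular_const c : regular (fun=> c)
| regular_entry i j : regular (fun g => g i j)
| regular_invdet : regular (fun g => (\det g)^-1)
| regular_add p q : regular p -> regular q -> regular (fun g => p g + q g)
| regular_mul p q : regular p -> regular q -> regular (fun g => p g * q g).

Definition zariski_closed (X : 'M[K]_n -> Prop) : Prop :=
  exists I : ('M[K]_n -> K) -> Prop, (forall p, I p -> regular p) /\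
    forall g, X g <-> g \in unitmx /\ forall p, I p -> p g = 0.

Record is_connected_algebraic_group (G : 'M[K]_n -> Prop) : Prop := {
  alg_group_closed : zariski_closed G;
  alg_group1 : G 1%:M;
  alg_groupM : forall g g', G g -> G g' -> G (g *m g');
  alg_groupV : forall g, G g -> G (invmx g);
  alg_group_connected : forall X Y, zariski_closed X -> zariski_closed Y ->
    (forall g, G g <-> X g \/ Y g) -> (forall g, ~ (X g /\ Y g)) ->
    (forall g, G g -> X g) \/ (forall g, G g -> Y g)
}.

(* ev identifies A with the Hopf algebra of regular functions on G. *)
Record is_coordinate_hopf (G : 'M[K]_n -> Prop) (A : comHopf K)
    (ev : A -> 'M[K]_n -> K) : Prop := {
  ev_inj : forall a b, (forall g, G g -> ev a g = ev b g) -> a = b;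
  ev_regular : forall a, exists2 p, regular p & forall g, G g -> ev a g = p g;
  ev_surj : forall p, regular p -> exists a, forall g, G g -> ev a g = p g;
  ev_linear : forall c a b g, G g -> ev (c *: a + b) g = c * ev a g + ev b g;
  evM : forall a b g, G g -> ev (a * b) g = ev a g * ev b g;
  ev1 : forall g, G g -> ev 1 g = 1;
  ev_cop : forall a g g', G g -> G g' ->
    ev a (g *m g') = \csw_(x, y <- cop a) (ev x g * ev y g');
  ev_counit : forall a, counit a = ev a 1%:M;
  ev_antipode : forall a g, G g -> ev (antipode a) g = ev a (invmx g)
}.

End MatrixGroups.

Section LieAlgebra.
Variables (K : fieldType) (A : comHopf K).

(* The Lie algebra of the group with coordinate algebra A: the tangent space at
   the identity, i.e. the point derivations at the counit. *)
Definition in_lie (D : A -> K) : Prop :=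
  scalar D /\ forall a b, D (a * b) = D a * counit b + counit a * D b.

Definition lie_bracket (D D' : A -> K) (a : A) : K :=
  \csw_(x, y <- cop a) (D x * D' y - D' x * D y).

Definition lie_subspace (U : (A -> K) -> Prop) : Prop :=
  [/\ forall D, U D -> in_lie D, U (fun=> 0) &
      forall c D D', U D -> U D' -> U (fun a => c * D a + D' a)].

Definition lie_simple : Prop :=
  (exists D D', [/\ in_lie D, in_lie D' & lie_bracket D D' <> (fun=> 0)]) /\
  forall U, lie_subspace U ->
    (forall D D', in_lie D -> U D' -> U (lie_bracket D D')) ->
    (forall D, U D -> D = (fun=> 0)) \/ (forall D, in_lie D -> U D).

Variable r : nat.

(* d i is half the squared length of the i-th simple root, short roots having
   squared length 2. *)
Record is_cartan (c : 'M[int]_r) (d : 'I_r -> nat) : Prop := {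
  cartan_diag : forall i, c i i = 2;
  cartan_offdiag : forall i j, i != j -> c i j <= 0;
  cartan_sym : forall i j, (d i)%:Z * c i j = (d j)%:Z * c j i;
  cartan_posdef : forall x : 'I_r -> int, (exists i, x i != 0) ->
    0 < \sum_i \sum_j x i * ((d i)%:Z * c i j) * x j;
  cartan_d_gt0 : forall i, (0 < d i)%N;
  cartan_d_gcd : \big[gcdn/0%N]_i d i = 1%N
}.

Record is_chevalley (c : 'M[int]_r) (h e f : 'I_r -> A -> K) : Prop := {
  chev_lie : forall i, [/\ in_lie (h i), in_lie (e i) & in_lie (f i)];
  chev_neq0 : forall i, e i <> (fun=> 0);
  chev_hh : forall i j, lie_bracket (h i) (h j) = (fun=> 0);
  chev_he : forall i j, lie_bracket (h i) (e j) = (fun a => (c i j)%:~R * e j a);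
  chev_hf : forall i j, lie_bracket (h i) (f j) = (fun a => - (c i j)%:~R * f j a);
  chev_ef : forall i j,
    lie_bracket (e i) (f j) = (if i == j then h i else fun=> 0);
  chev_gen : forall U, lie_subspace U ->
    (forall D D', U D -> U D' -> U (lie_bracket D D')) ->
    (forall i, U (e i) /\ U (f i)) -> forall D, in_lie D -> U D
}.

End LieAlgebra.

(* Generators of the Drinfeld-Jimbo algebra U_h(g). GK i b is the redundant
   generator q_i^(H_i/2) for b = true and its inverse for b = false; with it the
   coproduct of each generator is a finite sum. *)
Inductive dj_gen (r : nat) : Type :=
  GH of 'I_r | GE of 'I_r | GF of 'I_r | GK of 'I_r & bool.

Section DrinfeldJimbo.
Variables (K : fieldType) (r : nat) (c : 'M[int]_r) (d : 'I_r -> nat).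

Local Notation word := (seq (dj_gen r)).

(* exp(t h) and, for a matrix X over K[[h]], exp(t h X). *)
Definition hexp (t : K) : fps K := Fps (fun n => t ^+ n / n`!%:R).
Definition hexp_mx N (t : K) (X : 'M[fps K]_N.+1) : 'M[fps K]_N.+1 :=
  \matrix_(a, b) Fps (fun n =>
    \sum_(k < n.+1) t ^+ k / k`!%:R * (X ^+ k) a b (n - k)%N).

(* With q = exp(h/2) and q_i = q^(d i), one has q_i = exp(qlog i * h). *)
Definition qlog (i : 'I_r) : K := (d i)%:R / 2%:R.

(* Symmetric Gaussian binomial coefficient, for y the inverse of x, by the
   q-Pascal rule. *)
Fixpoint qbinom (x y : fps K) (m k : nat) : fps K :=
  match m, k with
  | _, 0%N => 1
  | 0%N, _.+1 => 0
  | m'.+1, k'.+1 => x ^+ k * qbinom x y m' k + y ^+ (m' - k') * qbinom x y m' k'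
  end.

(* Sum over k of (-1)^k [m choose k]_{q_i} X^(m-k) Y X^k with m = 1 - c i j. *)
Definition qserre N (i j : 'I_r) (X Y : 'M[fps K]_N.+1) : 'M[fps K]_N.+1 :=
  let m := `|1 - c i j|%N in
  \sum_(k < m.+1) ((-1) ^+ k * qbinom (hexp (qlog i)) (hexp (- qlog i)) m k) *:
    (X ^+ (m - k) * Y * X ^+ k).

(* Representations of U_h(g) on K[[h]]^(N+1). The relation for [E_i, F_i] is
   multiplied by q_i - q_i^-1, which is not a zero divisor. *)
Record is_dj_rep N (H E F : 'I_r -> 'M[fps K]_N.+1) : Prop := {
  dj_HH : forall i j, H i * H j = H j * H i;
  dj_HE : forall i j, H i * E j - E j * H i = (c i j)%:~R *: E j;
  dj_HF : forall i j, H i * F j - F j * H i = - (c i j)%:~R *: F j;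
  dj_EF : forall i j, (hexp (qlog i) - hexp (- qlog i)) *: (E i * F j - F j * E i) =
    if i == j then hexp_mx (qlog i) (H i) - hexp_mx (- qlog i) (H i) else 0;
  dj_serreE : forall i j, i != j -> qserre i j (E i) (E j) = 0;
  dj_serreF : forall i j, i != j -> qserre i j (F i) (F j) = 0
}.

Definition dj_eval_gen N (H E F : 'I_r -> 'M[fps K]_N.+1) (x : dj_gen r) :=
  match x with
  | GH i => H i
  | GE i => E i
  | GF i => F i
  | GK i b => hexp_mx ((if b then qlog i else - qlog i) / 2%:R) (H i)
  end.

Definition dj_eval N (H E F : 'I_r -> 'M[fps K]_N.+1) (w : word) : 'M[fps K]_N.+1 :=
  \prod_(x <- w) dj_eval_gen H E F x.

Definition dj_cop_gen (x : dj_gen r) : seq (word * word) :=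
  match x with
  | GH i => [:: ([:: GH i], [::]); ([::], [:: GH i])]
  | GE i => [:: ([:: GE i], [:: GK i true]); ([:: GK i false], [:: GE i])]
  | GF i => [:: ([:: GF i], [:: GK i true]); ([:: GK i false], [:: GF i])]
  | GK i b => [:: ([:: GK i b], [:: GK i b])]
  end.

Fixpoint dj_cop (w : word) : seq (word * word) :=
  if w is x :: w' then
    [seq (u.1 ++ v.1, u.2 ++ v.2) | u <- dj_cop_gen x, v <- dj_cop w']
  else [:: ([::], [::])].

Definition dj_counit (w : word) : fps K :=
  if all (fun x => if x is GK _ _ then true else false) w then 1 else 0.

Variables (A : comHopf K) (h e f : 'I_r -> A -> K).

(* The classical limit (reduction modulo h) of the representation is the
   differential of a representation rho of the group with coordinate algebra A. *)
Definition dj_integrates N (H E F : 'I_r -> 'M[fps K]_N.+1) : Prop :=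
  exists rho : 'M[A]_N.+1,
    [/\ forall k l, cop (rho k l) = \sum_m tpure (rho k m) (rho m l),
        forall k l, counit (rho k l) = (k == l)%:R &
        forall i, [/\ map_mx (fun s : fps K => s 0%N) (H i) = map_mx (h i) rho,
                      map_mx (fun s : fps K => s 0%N) (E i) = map_mx (e i) rho &
                      map_mx (fun s : fps K => s 0%N) (F i) = map_mx (f i) rho]].

(* The standard quantum group coordinate algebra, dual to U_h(g): the h-adic
   closure of the K[[h]]-module of matrix coefficients of the finite rank
   representations of U_h(g) whose classical limit integrates to the group. A
   functional on U_h(g) is given by its values on words in the generators,
   which span a dense subspace. *)
Definition in_quantum_coord (l : word -> fps K) : Prop :=
  forall n, exists N (H E F : 'I_r -> 'M[fps K]_N.+1)
      (xi : 'rV[fps K]_N.+1) (v : 'cV[fps K]_N.+1),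
    [/\ is_dj_rep H E F, dj_integrates H E F &
        forall w k, (k < n)%N -> l w k = (xi *m dj_eval H E F w *m v) 0 0 k].

(* Isomorphism of coalgebras and algebras. On functionals on words, the coproduct
   is dual to concatenation and the product is dual to dj_cop. *)
Record is_quantum_group_iso (Q : coquasi K)
    (theta : fps (cq_space Q) -> word -> fps K) : Prop := {
  qg_linear : forall w, scalar (theta^~ w);
  qg_inj : injective theta;
  qg_mem : forall a, in_quantum_coord (theta a);
  qg_surj : forall l, in_quantum_coord l -> exists a, theta a = l;
  qg_counit : forall a, cq_counit a = theta a [::];
  qg_cop : forall a w w',
    theta a (w ++ w') = \sw_(a1, a2 <- cq_cop a) (theta a1 w * theta a2 w');
  qg_one : theta (cq_one Q) = dj_counit;
  qg_mul : forall a b w,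
    theta (cq_mul a b) w = \sum_(u <- dj_cop w) theta a u.1 * theta b u.2
}.

End DrinfeldJimbo.

(* Main.v *)
Require Import Defs.
From HB Require Import structures.
From mathcomp Require Import all_boot all_order all_algebra.
From mathcomp Require Import boolp reals complex.
Import GRing.Theory.
Local Open Scope ring_scope.

(** Twisting by a cochain is a change of product by the action of a functional,
    and everything follows from the algebra of such actions.

    Let rho be a coaction of a coalgebra C on M. A functional f on C and a map g
    on M combine to conv f g = (x |-> f(x_(1)) g(x_(2))), and coassociativity of
    rho says precisely that this is an action: f.(f'.g) = (f * f').g, with * the
    convolution product on functionals (conv_assoc), while the counit acts
    trivially (conv_counit). As U (x) V is a comodule over A (x) A, and
    U (x) V (x) W over A (x) A (x) A (tcomod), the data of the theorem become:

    - the twisted product of m is F.m, on U (x) V (twist_mul_conv);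
    - the product of the cotwist is F * mu * F^-1, with mu the product of A
      (cotwist_mul_conv), so covariance of F.m is the cancellation of F^-1 * F
      (twist_mul_comodule_map);
    - the associator is phi = F_23 * F_1,23 * F^-1_12,3 * F^-1_12
      (cotwist_phi_conv), where the legs of F are functionals on A (x) A (x) A;
    - the product u(vw) is F_23.F_1,23.m and (uv)w is F_12.F_12,3.m, with m the
      undeformed triple product (twist_assoc_left, twist_assoc_right).

    Hence phi.((uv)w) = u(vw): the factors F^-1_12 F_12 and then F^-1_12,3 F_12,3
    cancel (conv_leg12_inv, conv_leg12_3_inv). The differential is a comodule map,
    so it commutes with the action of F, which gives the Leibniz rule; and since F
    is invertible, b dx = F^-1.(b . dx) expresses the classical generation of forms
    by the twisted product (twist_surj).

    To make this precise over power series, one needs that the Sweedler sum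
    \sw_(x, y <- t) e x y is the linear map on the completed tensor product induced
    by the bilinear map e. Linear maps of power series modules are determined by
    their values on constants (linear_hextend), hence linear maps out of a
    completed tensor product by their values on pure tensors (eq_linear_tens);
    identities between maps are all checked in this way. *)

Set Implicit Arguments.
Unset Strict Implicit.
Unset Printing Implicit Defensive.

(** * Linear maps and power series *)

Section LinearMaps.
Variables (K : comNzRingType) (V X : lmodType K).
Implicit Types (f g : V -> X).

Lemma linD f : linear f -> {morph f : x y / x + y}.
Proof. by move=> fl x y; have := fl 1 x y; rewrite !scale1r. Qed.

Lemma lin0 f : linear f -> f 0 = 0.
Proof. by move=> fl; apply: (addIr (f 0)); rewrite -linD // !add0r. Qed.

Lemma linZ f c : linear f -> {morph f : x / c *: x}.
Proof. by move=> fl x; have := fl c x 0; rewrite lin0 // !addr0. Qed.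

Lemma lin_sum f (I : Type) (r : seq I) (F : I -> V) : linear f ->
  f (\sum_(i <- r) F i) = \sum_(i <- r) f (F i).
Proof. by move=> fl; apply: big_morph; [exact: linD|exact: lin0]. Qed.

End LinearMaps.

Lemma coefh_sum (V : zmodType) (I : Type) (r : seq I) (F : I -> fps V) n :
  (\sum_(i <- r) F i) n = \sum_(i <- r) F i n.
Proof. by elim/big_rec2: _ => // i _ y _ <-. Qed.

Section Coefficients.
Variables (K : comNzRingType) (V : lmodType K).
Implicit Types (u : fps V).

Lemma coefh_scale_const (c : K) u n : (hconst c *: u) n = c *: u n.
Proof.
rewrite [LHS]big_ord_recl /= subn0 big1 ?addr0 // => i _.
by rewrite scale0r.
Qed.

Lemma hconstZD (c : K) (x y : V) : hconst (c *: x + y) = hconst c *: hconst x + hconst y.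
Proof.
by apply/fpsP => n; rewrite coefhD coefh_scale_const; case: n => //= n; rewrite scaler0 addr0.
Qed.

Lemma hconstD (x y : V) : hconst (x + y) = hconst x + hconst y.
Proof. by apply/fpsP => -[|n] //; rewrite coefhD /= addr0. Qed.

Lemma hconst0 : hconst (0 : V) = 0.
Proof. by apply/fpsP => -[|n]. Qed.

Lemma hconst_sum (I : Type) (r : seq I) (F : I -> V) :
  hconst (\sum_(i <- r) F i) = \sum_(i <- r) hconst (F i).
Proof. exact: (big_morph _ hconstD hconst0). Qed.

End Coefficients.

Section Extend.
Variables (K : comNzRingType) (V X : lmodType K).
Implicit Types (g : V -> fps X) (u : fps V).

(** The h-adically continuous extension of a map defined on constants. *)
Definition hextend (h : V -> fps X) (w : fps V) : fps X := hsum (fun n => h (w n)).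

(** Linearity over K, acting on fps X through constants. *)
Definition hlinear (g : V -> fps X) := forall c (x y : V), g (c *: x + y) = hconst c *: g x + g y.

Section Extensible.
Variables (g : V -> fps X) (gl : hlinear g).
Definition coef_map (n : nat) : V -> X := fun z => g z n.
Lemma coef_map_linear n : linear (coef_map n).
Proof. by move=> c x y; rewrite /coef_map gl coefhD coefh_scale_const. Qed.
HB.instance Definition _ n := GRing.isLinear.Build K V X *:%R (coef_map n) (coef_map_linear n).

(** The coefficients of g are linear maps, so the extension is a Cauchy product
    of u with a power series of linear maps; linearity is then associativity of
    Cauchy products. *)
Lemma hextend_linear : linear (hextend g).
Proof.
pose ap (v : V) (L : {linear V -> X}) := L v.
pose E := Fps (fun n => coef_map n : {linear V -> X}).
have hE u : hextend g u = hmap2 ap u E by [].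
move=> c u v; have -> : c *: hextend g u = hextend g (c *: u).
  rewrite !hE; apply: hmap2A => [L x y|L|a x y|a|a b L].
  - by rewrite /ap linearD.
  - by rewrite /ap linear0.
  - exact: scalerDr.
  - exact: scaler0.
  - by rewrite /ap linearZ.
apply/fpsP => n; rewrite coefhD /= -big_split; apply: eq_bigr => i _.
exact: (linD (coef_map_linear (n - i)%N)).
Qed.

Lemma hextend_const (v : V) : hextend g (hconst v) = g v.
Proof.
apply/fpsP => n /=; rewrite big_ord_recl /= subn0 big1 ?addr0 // => i _.
exact: (lin0 (coef_map_linear _)).
Qed.

End Extensible.
End Extend.

Section Continuity.
Variables (K : comNzRingType) (V X : lmodType K).

Definition hpow (n : nat) : fps K := Fps (fun m => (m == n)%:R).

Lemma coefh_hpow_scale (W : lmodType K) n (w : fps W) m :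
  (hpow n *: w) m = if (n <= m)%N then w (m - n)%N else 0.
Proof.
rewrite /=; case: leqP => le; last first.
  rewrite big1 // => i _; rewrite (_ : _ == _ = false) ?scale0r //.
  by apply/eqP => e; move: le (ltn_ord i); rewrite e ltnS => h; rewrite leqNgt h.
have lt : (n < m.+1)%N by [].
rewrite (bigD1 (Ordinal lt)) //= eqxx scale1r big1 ?addr0 // => i ne.
rewrite (_ : (i : nat) == n = false) ?scale0r //.
by apply: contraNF ne => /eqP e; apply/eqP/val_inj.
Qed.

Lemma coefh_hpow_sum (W : lmodType K) N (w : fps W) m :
  (\sum_(i < N) hpow i *: hconst (w i)) m = if (m < N)%N then w m else 0.
Proof.
rewrite coefh_sum; have Z (i : 'I_N) : (i : nat) != m ->
    (hpow i *: hconst (w i)) m = 0.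
  move=> ne; rewrite coefh_hpow_scale; case: leqP => // le.
  have : (0 < m - i)%N by rewrite subn_gt0 ltn_neqAle ne.
  by case: (m - i)%N.
case: ltnP => [lt|le].
  rewrite (bigD1 (Ordinal lt)) // big1 => [|i ne]; last exact/Z.
  by rewrite coefh_hpow_scale leqnn subnn [LHS]addr0.
by rewrite big1 // => i _; apply: Z; rewrite neq_ltn (leq_trans (ltn_ord i) le).
Qed.

(** Automatic continuity: modulo the N+1-st power of h, u is a finite
    combination of constants, and a linear f commutes with powers of h. *)
Lemma linear_hextend (f : fps V -> fps X) u : linear f ->
  f u = hextend (fun v => f (hconst v)) u.
Proof.
move=> fl; apply/fpsP => N.
(* tl is the tail of u, which contributes nothing up to order N *)
pose tl := Fps (fun m => u (m + N.+1)%N).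
have -> : u = (\sum_(i < N.+1) hpow i *: hconst (u i)) + hpow N.+1 *: tl.
  apply/fpsP => m; rewrite coefhD coefh_hpow_sum coefh_hpow_scale.
  case: ltnP => [lt|le]; first by rewrite addr0.
  by rewrite add0r /= subnK.
rewrite linD // linZ // coefhD coefh_hpow_scale ltnn addr0 lin_sum // coefh_sum.
apply: eq_bigr => i _; rewrite linZ // coefh_hpow_scale leq_ord.
congr (f (hconst _) _).
by rewrite coefhD coefh_hpow_sum ltn_ord coefh_hpow_scale ltnNge leq_ord addr0.
Qed.

Lemma eq_linear_const (f g : fps V -> fps X) : linear f -> linear g ->
  (forall v, f (hconst v) = g (hconst v)) -> forall u, f u = g u.
Proof.
move=> fl gl E u; rewrite (linear_hextend _ fl) (linear_hextend _ gl).
by congr (hextend _ _); apply: funext.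
Qed.

End Continuity.

(** * Sweedler sums over completed tensor products *)

Section FormalSums.
Variables (K : comNzRingType) (V X : lmodType K).

(** Automatic continuity again, now for sums of series that are not constant. *)
Lemma linear_hsum (f : fps V -> fps X) (s : nat -> fps V) : linear f ->
  f (hsum s) = hsum (fun n => f (s n)).
Proof.
move=> fl; apply/fpsP => N.
pose tl := Fps (fun m => hsum s (m + N.+1)%N - \sum_(i < N.+1) s i (m + N.+1 - i)%N).
have -> : hsum s = (\sum_(i < N.+1) hpow K i *: s i) + hpow K N.+1 *: tl.
  apply/fpsP => m; rewrite coefhD coefh_sum coefh_hpow_scale.
  have [le|lt] := leqP N.+1 m; last first.
    rewrite addr0; under [RHS]eq_bigr => i _ do rewrite coefh_hpow_scale.
    by rewrite -big_mkcond (big_ord_narrow_leq (lt : (m <= N)%N)).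
  rewrite (eq_bigr (fun i : 'I_N.+1 => s i (m - i)%N)) => [|i _].
    by rewrite [tl _]/= subnK // addrC subrK.
  by rewrite coefh_hpow_scale (leq_trans (ltnW (ltn_ord i)) le).
rewrite linD // linZ // coefhD coefh_hpow_scale ltnn addr0 lin_sum // coefh_sum.
by apply: eq_bigr => i _; rewrite linZ // coefh_hpow_scale leq_ord.
Qed.

End FormalSums.

Section FormalDoubleSums.
Variable V : zmodType.

Lemma hsum_sum (I : Type) (r : seq I) (s : I -> nat -> fps V) :
  \sum_(i <- r) hsum (s i) = hsum (fun n => \sum_(i <- r) s i n).
Proof.
apply/fpsP => N; rewrite coefh_sum exchange_big /=.
by apply: eq_bigr => i _; rewrite coefh_sum.
Qed.

Lemma hsum_exchange (s : nat -> nat -> fps V) :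
  hsum (fun n => hsum (s n)) = hsum (fun m => hsum (s^~ m)).
Proof.
apply/fpsP => N /=.
have T (F : nat -> nat -> V) : \sum_(i < N.+1) \sum_(j < (N - i).+1) F i j =
    \sum_(i < N.+1) \sum_(j < N.+1 | (i + j <= N)%N) F i j.
  apply: eq_bigr => i _; rewrite (big_ord_widen N.+1) ?ltnS ?leq_subr //.
  by apply: eq_bigl => j; rewrite ltnS leq_subRL // leq_ord.
rewrite (T (fun i j => s i j (N - i - j)%N)) (T (fun i j => s j i (N - i - j)%N)).
rewrite (exchange_big_dep predT) //=; apply: eq_bigr => i _.
by apply: eq_big => [j|j _]; rewrite ?[(j + i)%N]addnC // subnAC.
Qed.

End FormalDoubleSums.

Lemma eq_sw (K : comNzRingType) (V W : lmodType K) (X : zmodType)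
    (e e' : fps V -> fps W -> fps X) (t : fps (tens V W)) :
  (forall x y, e x y = e' x y) ->
  \sw_(x, y <- t) e x y = \sw_(x, y <- t) e' x y.
Proof.
move=> E; congr hsum; apply: funext => n.
by apply: eq_bigr => p _; apply: E.
Qed.

Section Sweedler.
Variables (K : comNzRingType) (V W X : lmodType K).
Implicit Types (e : fps V -> fps W -> fps X) (t : fps (tens V W)).

Lemma hpure_const (v : V) (w : W) : hpure (hconst v) (hconst w) = hconst (tpure v w).
Proof.
have [b1 b2] := tpure_bilin V W.
apply/fpsP => -[|n] /=; first by rewrite big_ord1.
rewrite big1 // => -[[|i] lt] _ /=; last by rewrite (lin0 (b2 _)).
exact: (lin0 (b1 _)).
Qed.

Lemma hlinear_csw e : bilin e ->
  hlinear (fun t : tens V W => \sum_(p <- repr t) e (hconst p.1) (hconst p.2)).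
Proof.
move=> [e1 e2] c s t; apply/fpsP => n; rewrite coefhD coefh_scale_const !coefh_sum.
have := @tlift_linear K V W X (fun v w => e (hconst v) (hconst w) n).
rewrite /tlift /teval; apply; split=> [v|w] d x y.
  by rewrite hconstZD e1 coefhD coefh_scale_const.
by rewrite hconstZD e2 coefhD coefh_scale_const.
Qed.

Lemma sw_linear e : bilin e -> linear (fun t => \sw_(x, y <- t) e x y).
Proof. by move=> be; apply: hextend_linear (hlinear_csw be). Qed.

Lemma sw_const e (t : tens V W) : bilin e ->
  \sw_(x, y <- hconst t) e x y = \csw_(x, y <- t) e (hconst x) (hconst y).
Proof. by move=> be; apply: hextend_const (hlinear_csw be) _. Qed.

End Sweedler.

Section Bilinear.
Variables (K : comNzRingType).

Lemma hmap2C (V W X : lmodType K) (m : V -> W -> X) u v :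
  hmap2 m u v = hmap2 (fun x y => m y x) v u.
Proof.
apply/fpsP => N /=; rewrite [LHS](reindex_inj rev_ord_inj) /=.
by apply: eq_bigr => i _; rewrite subSS subKn // -ltnS.
Qed.

Lemma hmap2_linear (V W X : lmodType K) (m : V -> W -> X) v :
  bilin m -> linear (fun u => hmap2 m u v).
Proof.
move=> [m1 m2] c x y; have -> : c *: hmap2 m x v = hmap2 m (c *: x) v.
  apply: hmap2A => [w a b|w|a w w'|a|a b d].
  - exact: (linD (m2 w)).
  - exact: (lin0 (m2 w)).
  - exact: scalerDr.
  - exact: scaler0.
  - by rewrite (linZ _ (m2 d)).
apply/fpsP => N; rewrite coefhD /= -big_split; apply: eq_bigr => i _.
exact: (linD (m2 _)).
Qed.

Lemma hmap2_bilin (V W X : lmodType K) (m : V -> W -> X) :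
  bilin m -> bilin (hmap2 m).
Proof.
move=> bm; split=> [u c x y|v]; last exact: hmap2_linear.
rewrite !(hmap2C m); apply: (hmap2_linear (m := fun y x => m x y)).
by case: bm.
Qed.

Lemma hpure_bilin (V W : lmodType K) : bilin (@hpure K V W).
Proof. exact/hmap2_bilin/tpure_bilin. Qed.

Lemma hmap_linear (V X : lmodType K) (f : V -> X) : linear f -> linear (hmap f).
Proof.
move=> fl c x y; apply/fpsP => N /=.
rewrite linD // lin_sum //; congr (_ + _).
by apply: eq_bigr => i _; rewrite linZ.
Qed.

End Bilinear.

Section SweedlerRules.
Variables (K : comNzRingType).
Implicit Types (U V W X Y Z : lmodType K).

(** The universal property of the completed tensor product, as an extensionality
    principle. *)
Lemma eq_linear_tens V W X (f g : fps (tens V W) -> fps X) :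
  linear f -> linear g -> (forall v w, f (hpure v w) = g (hpure v w)) ->
  forall t, f t = g t.
Proof.
move=> fl gl E; apply: eq_linear_const => // t.
rewrite [t]tens_sum_repr hconst_sum !lin_sum //.
by apply: eq_bigr => p _; rewrite -hpure_const.
Qed.

Lemma linear_id U : linear (fun z : fps U => z).
Proof. by []. Qed.

Lemma linear_comp U V X (f : fps V -> fps X) (g : fps U -> fps V) :
  linear f -> linear g -> linear (fun z => f (g z)).
Proof. by move=> fl gl c x y; rewrite gl fl. Qed.

Lemma linear_add U V (f g : fps U -> fps V) :
  linear f -> linear g -> linear (fun z => f z + g z).
Proof. by move=> fl gl c x y; rewrite fl gl scalerDr addrACA. Qed.

Lemma linear_bilinl U V W X (b : fps V -> fps W -> fps X) (g : fps U -> fps V) w :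
  bilin b -> linear g -> linear (fun z => b (g z) w).
Proof. by move=> [_ bl] gl c x y; rewrite gl; exact: bl. Qed.

Lemma linear_sw V W X Y (f : fps X -> fps Y) (e : fps V -> fps W -> fps X) t :
  linear f -> f (\sw_(x, y <- t) e x y) = \sw_(x, y <- t) f (e x y).
Proof.
move=> fl; rewrite /hsweedler linear_hsum //; congr hsum; apply: funext => n.
by rewrite lin_sum.
Qed.

Lemma sw_add V W X (e e' : fps V -> fps W -> fps X) t :
  \sw_(x, y <- t) (e x y + e' x y) = \sw_(x, y <- t) e x y + \sw_(x, y <- t) e' x y.
Proof.
apply/fpsP => N; rewrite coefhD /= -big_split; apply: eq_bigr => i _.
by rewrite big_split.
Qed.

Lemma sw_body_linear U V W X (e : fps U -> fps V -> fps W -> fps X) t :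
  (forall x y, linear (fun z => e z x y)) -> linear (fun z => \sw_(x, y <- t) e z x y).
Proof.
move=> el c u v /=.
rewrite (linear_sw (f := fun z => c *: z)) => [|a x y]; last first.
  by rewrite scalerDr !scalerA mulrC.
by rewrite -sw_add; apply: eq_sw => x y; apply: el.
Qed.

Lemma sw_tens_linear U V W X (e : fps V -> fps W -> fps X) (t : fps U -> fps (tens V W)) :
  bilin e -> linear t -> linear (fun z => \sw_(x, y <- t z) e x y).
Proof. by move=> be tl; apply: (linear_comp (sw_linear be) tl). Qed.

Lemma sw_pure V W X (e : fps V -> fps W -> fps X) v w : bilin e ->
  \sw_(x, y <- hpure v w) e x y = e v w.
Proof.
move=> be; move: v w; have [hp1 hp2] := hpure_bilin V W.
have swl := sw_linear be; have [e1 e2] := be.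
move=> v w; move: v; apply: eq_linear_const => [||v].
- exact: (linear_comp swl).
- exact: e2.
move: w; apply: eq_linear_const => [||w].
- exact: (linear_comp swl).
- exact: e1.
rewrite hpure_const sw_const //.
have := @tlift_pure _ V W; rewrite /tlift /teval => tp.
apply/fpsP => n; rewrite coefh_sum.
apply: (tp _ (fun v w => e (hconst v) (hconst w) n)).
split=> [u|u] d x y.
  by rewrite hconstZD e1 coefhD coefh_scale_const.
by rewrite hconstZD e2 coefhD coefh_scale_const.
Qed.

Lemma sw_sw V W X Y Z (e : fps V -> fps W -> fps (tens X Y))
    (f : fps X -> fps Y -> fps Z) t : bilin f ->
  \sw_(x, y <- \sw_(a, b <- t) e a b) f x y =
  \sw_(a, b <- t) \sw_(x, y <- e a b) f x y.
Proof.
move=> bf; rewrite (linear_sw (f := fun t => \sw_(x, y <- t) f x y)) //.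
exact: sw_linear.
Qed.

(** Both sides are the same double sum of Cauchy type. *)
Lemma sw_exchange U V W X (Y : zmodType) (e : fps U -> fps V -> fps W -> fps X -> fps Y) s t :
  \sw_(a, b <- s) \sw_(x, y <- t) e a b x y =
  \sw_(x, y <- t) \sw_(a, b <- s) e a b x y.
Proof.
rewrite /hsweedler.
under eq_fun => n do rewrite hsum_sum.
rewrite hsum_exchange; congr hsum; apply: funext => m.
rewrite hsum_sum; congr hsum; apply: funext => n.
exact: exchange_big.
Qed.

Lemma scale_bilin X : bilin (fun (s : fps K^o) (x : fps X) => (s : fps K) *: x).
Proof.
split=> [s c x y|x c s s'].
  by rewrite scalerDr !scalerA mulrC.
by rewrite scalerDl -scalerA.
Qed.

Lemma scaler_bilin X : bilin (fun (x : fps X) (s : fps K^o) => (s : fps K) *: x).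
Proof. by case: (scale_bilin X). Qed.

Lemma scale_sw V W X (e : fps V -> fps W -> fps X) (c : fps K) t :
  c *: (\sw_(x, y <- t) e x y) = \sw_(x, y <- t) (c *: e x y).
Proof. by apply: (linear_sw (f := fun z => c *: z)); case: (scale_bilin X). Qed.

Lemma sw_scale V W X (e : fps V -> fps W -> fps K^o) (u : fps X) t :
  (\sw_(x, y <- t) e x y : fps K) *: u = \sw_(x, y <- t) ((e x y : fps K) *: u).
Proof.
by apply: (linear_sw (f := fun z : fps K^o => (z : fps K) *: u)); case: (scale_bilin X).
Qed.

End SweedlerRules.

(** lin proves linear f or bilin f by following the syntax of f; lin_hyp is a hook
    for the linearity of the structure maps introduced below. The backtracking match
    matters: a metavariable that should not depend on the bound variable may capture
    it, and the branch then fails. *)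
Ltac lin_hyp := fail.
Ltac lin :=
  cbv beta;
  match goal with
  | |- bilin _ =>
    first [ assumption | exact: hpure_bilin | exact: scale_bilin | exact: scaler_bilin
          | lin_hyp
          | (split; intro; lin) ]
  | |- GRing.linear_for _ (fun z => z) => exact: linear_id
  | |- GRing.linear_for _ (fun z => (@?f z + @?g z)%R) =>
    refine (@linear_add _ _ _ f g _ _); lin
  | |- GRing.linear_for _ (fun z => hsweedler ?t (@?e z)) =>
    refine (@sw_body_linear _ _ _ _ _ e t _); intros ? ?; lin
  | |- GRing.linear_for _ (fun z => hsweedler (@?t z) ?e) =>
    refine (@sw_tens_linear _ _ _ _ _ e t _ _); lin
  | |- GRing.linear_for _ (fun z => (?s *: @?g z)%R) =>
    refine (@linear_comp _ _ _ _ (fun w => s *: w) g (proj1 (scale_bilin _) s) _); lin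
  | |- GRing.linear_for _ (fun z => (@?g z *: ?v)%R) =>
    refine (@linear_comp _ _ _^o _ (fun w => (w : fps _) *: v) g (proj2 (scale_bilin _) v) _); lin
  | |- GRing.linear_for _ (fun z => ?f (@?g z)) =>
    refine (@linear_comp _ _ _ _ f g _ _); [ lin_fun | lin]
  | |- GRing.linear_for _ (fun z => ?b (@?g z) ?w) =>
    refine (@linear_bilinl _ _ _ _ _ b g w _ _); lin
  | |- GRing.linear_for _ _ => lin_fun
  end
with lin_fun :=
  first [ assumption
        | match goal with H : bilin ?b |- GRing.linear_for _ (?b _) => exact (proj1 H _) end
        | match goal with H : bilin ?b |- GRing.linear_for _ (fun z => ?b z _) => exact (proj2 H _) end
        | lin_hyp
        | exact: (proj1 (hpure_bilin _ _) _) ].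

(** * Comodules and convolution *)

Section Comodules.
Variables (K : comNzRingType).
Implicit Types (C D M N : lmodType K).

(** Bundling the linearity of the coproduct and the counit makes a single hypothesis
    sufficient for lin; a coalgebra appears as a comodule over itself. *)
Record hcomod C M (D : fps C -> fps (tens C C)) (ep : fps C -> fps K^o)
    (rho : fps M -> fps (tens C M)) : Prop := {
  hcop_linear : linear D;
  hcounit_linear : linear ep;
  hcomod_linear : linear rho;
  hcomod_coassoc : forall v,
    \sw_(a, x <- rho v) \sw_(a1, a2 <- D a) hpure (hpure a1 a2) x =
    \sw_(a, x <- rho v) \sw_(b, y <- rho x) hpure (hpure a b) y;
  hcomod_counit : forall v, \sw_(a, x <- rho v) ((ep a : fps K) *: x) = v
}.

Definition trilin (U V W X : lmodType K) (T : fps U -> fps V -> fps W -> fps X) :=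
  [/\ forall v w, linear (fun u => T u v w), forall u w, linear (fun v => T u v w)
    & forall u v, linear (fun w => T u v w)].

Section Trilin.
Variables (U V W X : lmodType K) (T : fps U -> fps V -> fps W -> fps X) (tT : trilin T).
Lemma trilin1 v w : linear (fun u => T u v w). Proof. by case: tT. Qed.
Lemma trilin2 u w : linear (fun v => T u v w). Proof. by case: tT. Qed.
Lemma trilin3 u v : linear (fun w => T u v w). Proof. by case: tT. Qed.
Lemma trilin23 u : bilin (T u).
Proof. by split=> v; [exact: trilin3|exact: trilin2]. Qed.
End Trilin.

End Comodules.

Ltac lin_hyp ::= first
 [ match goal with H : hcomod _ _ ?r |- GRing.linear_for _ ?r => exact: (hcomod_linear H) end
 | match goal with H : hcomod ?r _ _ |- GRing.linear_for _ ?r => exact: (hcop_linear H) end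
 | match goal with H : trilin ?T |- GRing.linear_for _ (fun u => ?T u _ _) => exact: (trilin1 H) end
 | match goal with H : trilin ?T |- GRing.linear_for _ (fun u => ?T _ u _) => exact: (trilin2 H) end
 | match goal with H : trilin ?T |- GRing.linear_for _ (fun u => ?T _ _ u) => exact: (trilin3 H) end
 | match goal with H : trilin ?T |- GRing.linear_for _ (?T _ _) => exact: (trilin3 H) end
 | match goal with H : trilin ?T |- bilin (?T _) => exact: (trilin23 H) end
].

Section ComoduleTheory.
Variables (K : comNzRingType).

Section Convolution.
Variables (C M : lmodType K) (D : fps C -> fps (tens C C)) (ep : fps C -> fps K^o).
Variables (rho : fps M -> fps (tens C M)) (hM : hcomod D ep rho).

(** Coassociativity in the form used in Sweedler calculus: the universal case is the
    axiom, and any trilinear T factors through it. *)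
Lemma coassocE (X : lmodType K) (T : fps C -> fps C -> fps M -> fps X) v : trilin T ->
  \sw_(a, x <- rho v) \sw_(a1, a2 <- D a) T a1 a2 x =
  \sw_(a, x <- rho v) \sw_(b, y <- rho x) T a b y.
Proof.
move=> tT.
have bT2 x : bilin (fun a b => T a b x) by lin.
pose G (t : fps (tens (tens C C) M)) := \sw_(c, x <- t) \sw_(a, b <- c) T a b x.
have bG : bilin (fun c x => \sw_(a, b <- c) T a b x) by lin.
have Gl : linear G by apply: sw_linear.
have Gp a b x : G (hpure (hpure a b) x) = T a b x by rewrite /G sw_pure // sw_pure.
have := congr1 G (hcomod_coassoc hM v).
rewrite !(linear_sw _ _ Gl).
rewrite (eq_sw (e' := fun a x => \sw_(a1, a2 <- D a) T a1 a2 x)); last first.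
  by move=> a x; rewrite (linear_sw _ _ Gl); apply: eq_sw.
move=> ->; apply: eq_sw => a x.
by rewrite (linear_sw _ _ Gl); apply: eq_sw.
Qed.

End Convolution.

(** With M = C this is the convolution of maps on a coalgebra; with b the scaling it
    is the action of the functional f on maps out of M. *)
Definition conv (C M P Q X : lmodType K) (rho : fps M -> fps (tens C M))
    (b : fps P -> fps Q -> fps X) (f : fps C -> fps P) (g : fps M -> fps Q) (x : fps M) :=
  \sw_(a, y <- rho x) b (f a) (g y).

Lemma conv_linear (C M P Q X : lmodType K) (rho : fps M -> fps (tens C M))
    (b : fps P -> fps Q -> fps X) (f : fps C -> fps P) (g : fps M -> fps Q) :
  linear rho -> bilin b -> linear f -> linear g -> linear (conv rho b f g).
Proof. by move=> rl bb fl gl; rewrite /conv; lin. Qed.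

Lemma linear_conv (C M P Q X Y : lmodType K) (rho : fps M -> fps (tens C M))
    (b : fps P -> fps Q -> fps X) (f : fps C -> fps P) (g : fps M -> fps Q)
    (h : fps X -> fps Y) x : linear h ->
  h (conv rho b f g x) = conv rho (fun p q => h (b p q)) f g x.
Proof. exact: linear_sw. Qed.

Section Assoc.
Variables (C M : lmodType K) (D : fps C -> fps (tens C C)) (ep : fps C -> fps K^o).
Variables (rho : fps M -> fps (tens C M)) (hM : hcomod D ep rho).

(** Four pairings are needed because the factors are in turn scalars, elements of A
    and elements of comodules; b1, ..., b4 are any compatible bilinear maps. *)
Lemma conv_assoc (P Q R Y Z X : lmodType K)
    (b1 : fps P -> fps Y -> fps X) (b2 : fps Q -> fps R -> fps Y)
    (b3 : fps Z -> fps R -> fps X) (b4 : fps P -> fps Q -> fps Z)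
    (f : fps C -> fps P) (g : fps C -> fps Q) (k : fps M -> fps R) x :
  bilin b1 -> bilin b2 -> bilin b3 -> bilin b4 ->
  linear f -> linear g -> linear k ->
  (forall p q r, b1 p (b2 q r) = b3 (b4 p q) r) ->
  conv rho b1 f (conv rho b2 g k) x = conv rho b3 (conv D b4 f g) k x.
Proof.
move=> bb1 bb2 bb3 bb4 fl gl kl E.
have tT : trilin (fun a b z => b3 (b4 (f a) (g b)) (k z)) by split=> ? ?; lin.
transitivity (\sw_(a, y <- rho x) \sw_(b, z <- rho y) b3 (b4 (f a) (g b)) (k z)).
  apply: eq_sw => a y; rewrite /conv (linear_sw _ _ (proj1 bb1 _)).
  by apply: eq_sw => b z.
rewrite -(coassocE hM x tT); apply: eq_sw => a z; rewrite /conv.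
by rewrite (linear_sw (f := fun c => b3 c (k z))) //; case: bb3.
Qed.

Lemma conv_counit (X : lmodType K) (m : fps M -> fps X) x : linear m ->
  conv rho (fun (s : fps K^o) y => (s : fps K) *: y) ep m x = m x.
Proof.
move=> ml; rewrite -[in RHS](hcomod_counit hM x) linear_sw //.
by apply: eq_sw => a y; rewrite (linZ _ ml).
Qed.

End Assoc.
End ComoduleTheory.

(** * Tensor products of comodules *)

Section TensorComodules.
Variables (K : comNzRingType).

Definition tcoact (C C' M M' : lmodType K) (rho : fps M -> fps (tens C M))
    (rho' : fps M' -> fps (tens C' M')) (t : fps (tens M M')) :
    fps (tens (tens C C') (tens M M')) :=
  \sw_(u, v <- t) \sw_(a, x <- rho u) \sw_(b, y <- rho' v)
    hpure (hpure a b) (hpure x y).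

Definition tcounit (C C' : lmodType K) (ep : fps C -> fps K^o) (ep' : fps C' -> fps K^o)
    (t : fps (tens C C')) : fps K^o :=
  \sw_(a, b <- t) ((ep a : fps K) *: ep' b).

Section TensorBilinear.
Variables (C C' M M' : lmodType K) (rho : fps M -> fps (tens C M))
    (rho' : fps M' -> fps (tens C' M')).
Hypotheses (rl : linear rho) (rl' : linear rho').

Lemma tcoact_bilin : bilin (fun u v => \sw_(a, x <- rho u) \sw_(b, y <- rho' v)
    hpure (hpure a b) (hpure x y)).
Proof. by lin. Qed.

Lemma tcoact_linear : linear (tcoact rho rho').
Proof. exact/sw_linear/tcoact_bilin. Qed.

Lemma sw_tcoact (X : lmodType K) (G : fps (tens C C') -> fps (tens M M') -> fps X) u v :
  bilin G ->
  \sw_(c, z <- tcoact rho rho' (hpure u v)) G c z =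
  \sw_(a, x <- rho u) \sw_(b, y <- rho' v) G (hpure a b) (hpure x y).
Proof.
move=> bG; rewrite /tcoact sw_pure; last exact: tcoact_bilin.
rewrite sw_sw //; apply: eq_sw => a x; rewrite sw_sw //.
by apply: eq_sw => b y; rewrite sw_pure.
Qed.

End TensorBilinear.

Lemma tcounit_linear (C C' : lmodType K) (ep : fps C -> fps K^o) (ep' : fps C' -> fps K^o) :
  linear ep -> linear ep' -> linear (tcounit ep ep').
Proof. by move=> el el'; apply: sw_linear; lin. Qed.

Lemma tcounit_pure (C C' : lmodType K) (ep : fps C -> fps K^o) (ep' : fps C' -> fps K^o) a b :
  linear ep -> linear ep' -> tcounit ep ep' (hpure a b) = (ep a : fps K) *: ep' b.
Proof. by move=> el el'; apply: sw_pure; lin. Qed.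

Section Tensor.
Variables (C C' M M' : lmodType K).
Variables (D : fps C -> fps (tens C C)) (ep : fps C -> fps K^o) (rho : fps M -> fps (tens C M)).
Variables (D' : fps C' -> fps (tens C' C')) (ep' : fps C' -> fps K^o)
  (rho' : fps M' -> fps (tens C' M')).
Hypotheses (hM : hcomod D ep rho) (hM' : hcomod D' ep' rho').

(** On pure tensors, both sides of coassociativity split, after exchanging sums, into
    the coassociativity of each factor. *)
Lemma tcomod : hcomod (tcoact D D') (tcounit ep ep') (tcoact rho rho').
Proof.
have [Dl el rl co cu] := hM; have [Dl' el' rl' co' cu'] := hM'.
have tDl := tcoact_linear Dl Dl'; have trl := tcoact_linear rl rl'.
have tel := tcounit_linear el el'.
split=> //.
- apply: eq_linear_tens => [||u v].
  + by lin.
  + by lin.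
  rewrite !sw_tcoact //; try lin.
  transitivity (\sw_(a, x <- rho u) \sw_(b, y <- rho' v)
      \sw_(a1, a2 <- D a) \sw_(b1, b2 <- D' b)
      hpure (hpure (hpure a1 b1) (hpure a2 b2)) (hpure x y)).
    by apply: eq_sw => a x; apply: eq_sw => b y; rewrite sw_tcoact //; lin.
  transitivity (\sw_(a, x <- rho u) \sw_(b, y <- rho' v)
      \sw_(a', x' <- rho x) \sw_(b', y' <- rho' y)
      hpure (hpure (hpure a b) (hpure a' b')) (hpure x' y')); last first.
    by apply: eq_sw => a x; apply: eq_sw => b y; rewrite sw_tcoact //; lin.
  transitivity (\sw_(a, x <- rho u) \sw_(a1, a2 <- D a) \sw_(b, y <- rho' v) \sw_(b1, b2 <- D' b)
      hpure (hpure (hpure a1 b1) (hpure a2 b2)) (hpure x y)).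
    by apply: eq_sw => a x; exact: sw_exchange.
  transitivity (\sw_(a, x <- rho u) \sw_(a', x' <- rho x) \sw_(b, y <- rho' v)
      \sw_(b', y' <- rho' y)
      hpure (hpure (hpure a b) (hpure a' b')) (hpure x' y')); last first.
    by apply: eq_sw => a x; exact: sw_exchange.
  rewrite (coassocE hM (T := fun a1 a2 x => \sw_(b, y <- rho' v) \sw_(b1, b2 <- D' b)
      hpure (hpure (hpure a1 b1) (hpure a2 b2)) (hpure x y))); last first.
    by split=> ? ?; lin.
  apply: eq_sw => a x; apply: eq_sw => a' x'.
  apply: (coassocE hM' (T := fun b1 b2 y =>
      hpure (hpure (hpure a b1) (hpure a' b2)) (hpure x' y))).
  by split=> ? ?; lin.
apply: eq_linear_tens => [||u v].
- by lin.
- by lin.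
have [h1 h2] := hpure_bilin M M'.
rewrite sw_tcoact //; last by lin.
transitivity (\sw_(a, x <- rho u) \sw_(b, y <- rho' v)
   hpure ((ep a : fps K) *: x) ((ep' b : fps K) *: y)).
  apply: eq_sw => a x; apply: eq_sw => b y; rewrite tcounit_pure //.
  by rewrite (linZ _ (h1 _)) (linZ _ (h2 _)) scalerA mulrC.
rewrite -[in RHS](cu u) -[in RHS](cu' v).
rewrite (linear_sw _ _ (h2 _)); apply: eq_sw => a x.
by rewrite (linear_sw _ _ (h1 _)).
Qed.

End Tensor.
End TensorComodules.

(** * Extension of classical structures to power series *)

Section Constants.
Variables (K : comNzRingType).
Implicit Types (U V W X : lmodType K).

Lemma eq_bilin_const U V X (b b' : fps U -> fps V -> fps X) : bilin b -> bilin b' ->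
  (forall u v, b (hconst u) (hconst v) = b' (hconst u) (hconst v)) ->
  forall u v, b u v = b' u v.
Proof.
move=> [b1 b2] [c1 c2] E u v; move: u.
apply: eq_linear_const => // u; move: v.
exact: eq_linear_const.
Qed.

Lemma hconstZ U (c : K) (x : U) : hconst (c *: x) = hconst c *: hconst x.
Proof. by have := hconstZD c x 0; rewrite hconst0 !addr0. Qed.

Lemma hmap_const U V (f : U -> V) u : linear f -> hmap f (hconst u) = hconst (f u).
Proof. by move=> fl; apply/fpsP => -[|n] //=; rewrite lin0. Qed.

Lemma hmap2_const U V W (m : U -> V -> W) u v : bilin m ->
  hmap2 m (hconst u) (hconst v) = hconst (m u v).
Proof.
move=> [m1 m2]; apply/fpsP => -[|n] /=; first by rewrite big_ord1.
rewrite big1 // => -[[|i] lt] _ /=; last exact: (lin0 (m2 _)).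
exact: (lin0 (m1 _)).
Qed.

Definition hlift V W X (b : fps V -> fps W -> fps X) (t : fps (tens V W)) : fps X :=
  \sw_(x, y <- t) b x y.

Lemma hlift_linear V W X (b : fps V -> fps W -> fps X) : bilin b -> linear (hlift b).
Proof. exact: sw_linear. Qed.

Lemma hlift_pure V W X (b : fps V -> fps W -> fps X) v w : bilin b ->
  hlift b (hpure v w) = b v w.
Proof. exact: sw_pure. Qed.

Definition hlift3 U V W X (T : fps U -> fps V -> fps W -> fps X)
    (t : fps (tens (tens U V) W)) : fps X :=
  \sw_(s, z <- t) \sw_(x, y <- s) T x y z.

Lemma hlift3_linear U V W X (T : fps U -> fps V -> fps W -> fps X) : trilin T ->
  linear (hlift3 T).
Proof. by move=> tT; rewrite /hlift3; lin. Qed.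

Lemma hlift3_pure U V W X (T : fps U -> fps V -> fps W -> fps X) u v w : trilin T ->
  hlift3 T (hpure (hpure u v) w) = T u v w.
Proof. by move=> tT; rewrite /hlift3 !sw_pure //; lin. Qed.

Lemma eq_linear_tens3 U V W X (f g : fps (tens (tens U V) W) -> fps X) :
  linear f -> linear g ->
  (forall u v w, f (hpure (hpure u v) w) = g (hpure (hpure u v) w)) -> forall t, f t = g t.
Proof.
move=> fl gl E; apply: eq_linear_tens => // s w; move: s.
by apply: eq_linear_tens => [||u v] //; lin.
Qed.

End Constants.

Section ClassicalExtension.
Variables (K : fieldType) (A : comHopf K).
Local Notation D := (hmap (@cop K A)).
Definition hcounit : fps A -> fps K^o := hmap (@counit K A).
Local Notation ep := hcounit.

Lemma hcomod_classical (V : lmodType K) (co : V -> tens A V) :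
  is_comodule co -> hcomod D ep (hmap co).
Proof.
move=> [cl ca cu].
have Dl : linear D by exact: hmap_linear (@cop_linear K A).
have el : linear ep by exact: (@hmap_linear _ _ K^o _ (@counit_linear K A)).
have col := hmap_linear cl.
split=> //; apply: eq_linear_const => //; try by lin.
- move=> v; rewrite hmap_const // !sw_const; [|by lin..].
  have := congr1 (@hconst _) (ca v); rewrite !hconst_sum => E.
  etransitivity; last (etransitivity; first exact: E).
    apply: eq_bigr => p _ /=; rewrite hmap_const; last exact: cop_linear.
    rewrite sw_const; last by lin.
    by rewrite hconst_sum; apply: eq_bigr => q _; rewrite !hpure_const.
  apply: eq_bigr => p _ /=; rewrite hmap_const // sw_const; last by lin.
  by rewrite hconst_sum; apply: eq_bigr => q _; rewrite !hpure_const.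
- move=> v; rewrite hmap_const // !sw_const; last by lin.
  rewrite -[in RHS](cu v) hconst_sum; apply: eq_bigr => p _ /=.
  rewrite [ep _](@hmap_const K A K^o); last exact: counit_linear.
  exact: (esym (hconstZ _ _)).
Qed.

Lemma hopf_comodule : is_comodule (@cop K A).
Proof. by split; [exact: cop_linear|exact: cop_coassoc|exact: cop_counitl]. Qed.

Lemma is_hcomodule_classical (F Fi : fps A -> fps A -> fps K) (V : lmodType K)
    (co : V -> tens A V) :
  is_comodule co -> @is_hcomodule _ (cotwist F Fi) V (hmap co).
Proof. by move=> /hcomod_classical[]. Qed.

Lemma mulr_bilin : bilin (@GRing.mul A).
Proof.
by split=> a c x y; [rewrite mulrDr scalerAr|rewrite mulrDl scalerAl].
Qed.

Lemma mul_bilin : bilin (@GRing.mul (fps A)).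
Proof. exact: hmap2_bilin mulr_bilin. Qed.

Section CovariantProduct.
Variables (U V W : lmodType K) (coU : U -> tens A U) (coV : V -> tens A V)
    (coW : W -> tens A W) (m : U -> V -> W).
Hypotheses (cU : linear coU) (cV : linear coV) (cW : linear coW) (bm : bilin m).
Hypothesis coM : forall u v, coW (m u v) =
    \csw_(a, x <- coU u) \csw_(b, y <- coV v) tpure (a * b) (m x y).
Let hU := hmap_linear cU.
Let hV := hmap_linear cV.
Let hW := hmap_linear cW.
Let bM := hmap2_bilin bm.
Let bmu := mul_bilin.

Lemma hmap_coact_mul u v : hmap coW (hmap2 m u v) =
  \sw_(a, x <- hmap coU u) \sw_(b, y <- hmap coV v) hpure (a * b) (hmap2 m x y).
Proof.
move: u v; apply: eq_bilin_const; [by lin..|] => u v.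
rewrite hmap2_const // !hmap_const // coM hconst_sum sw_const; last by lin.
apply: eq_bigr => p _; rewrite sw_const; last by lin.
rewrite hconst_sum; apply: eq_bigr => q _ /=.
rewrite [hconst p.1 * _]hmap2_const; last exact: mulr_bilin.
by rewrite hmap2_const // hpure_const.
Qed.

(** The product is a map of comodules over the product of A: the form of covariance
    that convolutions can use. *)
Lemma hmap_coact_lift t : hmap coW (hlift (hmap2 m) t) =
    conv (tcoact (hmap coU) (hmap coV)) (@hpure K A W)
      (hlift (@GRing.mul (fps A))) (hlift (hmap2 m)) t.
Proof.
have ml := hlift_linear bM; have mul := hlift_linear bmu.
have tl := tcoact_linear hU hV.
move: t; apply: eq_linear_tens; [by lin|by apply: conv_linear; lin|] => u v.
rewrite hlift_pure // /conv sw_tcoact //; last by lin.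
rewrite hmap_coact_mul; apply: eq_sw => a x; apply: eq_sw => b y.
by rewrite !hlift_pure.
Qed.

End CovariantProduct.

End ClassicalExtension.

Arguments hcounit {K} A.

(** * Twisting products by a cochain *)

Section Cotwisting.
Variables (K : fieldType) (A : comHopf K) (F Fi : fps A -> fps A -> fps K^o).
Hypothesis hF : is_cochain F Fi.
Local Notation D := (hmap (@cop K A)).
Local Notation ep := (hcounit A).
Local Notation D2 := (tcoact D D).
Local Notation ep2 := (tcounit ep ep).
Local Notation D3 := (tcoact D2 D).
Local Notation ep3 := (tcounit ep2 ep).
Local Notation mu := (hlift (@GRing.mul (fps A))).
Local Notation sc := (fun (s : fps K^o) y => (s : fps K) *: y).

Let hA : hcomod D ep D := hcomod_classical (hopf_comodule A).
Let hA2 : hcomod D2 ep2 D2 := tcomod hA hA.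
Let hA3 : hcomod D3 ep3 D3 := tcomod hA2 hA.
Let Dl : linear D := hcop_linear hA.
Let epl : linear ep := hcounit_linear hA.
Let bmul : bilin (@GRing.mul (fps A)) := mul_bilin A.

Lemma cochain_bilin : bilin F.
Proof. by case: hF => -[]. Qed.
Lemma cochain_inv_bilin : bilin Fi.
Proof. by case: hF => _ []. Qed.

Let bF := cochain_bilin.
Let bFi := cochain_inv_bilin.

Let Fl : linear (hlift F) := hlift_linear bF.
Let Fil : linear (hlift Fi) := hlift_linear bFi.
Let mul : linear mu := hlift_linear bmul.

Lemma conv_inverse_lift (P Q : fps A -> fps A -> fps K^o) t :
  bilin P -> bilin Q -> conv_inverse P Q ->
  conv D2 sc (hlift P) (hlift Q) t = ep2 t.
Proof.
move=> bP bQ PQ; have Pl := hlift_linear bP; have Ql := hlift_linear bQ.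
move: t; apply: eq_linear_tens.
- by apply: conv_linear; lin.
- exact: tcounit_linear.
move=> a b; rewrite tcounit_pure // /conv sw_tcoact //; try by lin.
rewrite -[RHS]PQ; apply: eq_sw => a1 a2; apply: eq_sw => b1 b2.
by rewrite !hlift_pure.
Qed.

Lemma cotwist_mul_conv a b :
  cotwist_mul F Fi a b =
  conv D2 sc (hlift F)
    (conv D2 (fun y (s : fps K^o) => (s : fps K) *: y) mu (hlift Fi)) (hpure a b).
Proof.
have il : linear (conv D2 (fun y (s : fps K^o) => (s : fps K) *: y) mu (hlift Fi)).
  by apply: conv_linear; lin.
rewrite {1}/conv sw_tcoact; [|by lin..].
apply: eq_sw => a1 a'; rewrite sw_exchange; apply: eq_sw => b1 b'.
rewrite hlift_pure // /conv sw_tcoact; [|by lin..].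
rewrite scale_sw; apply: eq_sw => a2 a3; rewrite scale_sw; apply: eq_sw => b2 b3.
by rewrite !hlift_pure // scalerA.
Qed.

Section TwistedProduct.
Variables (U V W : lmodType K) (coU : U -> tens A U) (coV : V -> tens A V)
  (coW : W -> tens A W) (m : U -> V -> W).
Hypotheses (hU : is_comodule coU) (hV : is_comodule coV) (hW : is_comodule coW).
Hypotheses (bm : bilin m)
  (coM : forall u v, coW (m u v) =
    \csw_(a, x <- coU u) \csw_(b, y <- coV v) tpure (a * b) (m x y)).

Let cU := hcomod_classical hU.
Let cV := hcomod_classical hV.
Let cW := hcomod_classical hW.
Let cUV := tcomod cU cV.
Let bM : bilin (hmap2 m) := hmap2_bilin bm.
Let ml : linear (hlift (hmap2 m)) := hlift_linear bM.

Local Notation rho2 := (tcoact (hmap coU) (hmap coV)).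

Lemma twist_mul_conv u v :
  twist_mul F coU coV m u v = conv rho2 sc (hlift F) (hlift (hmap2 m)) (hpure u v).
Proof.
rewrite /conv sw_tcoact; [|by lin..].
by apply: eq_sw => a x; apply: eq_sw => b y; rewrite !hlift_pure.
Qed.

Lemma twist_mul_bilin : bilin (twist_mul F coU coV m).
Proof. by rewrite /twist_mul; lin. Qed.

(** (F * mu * F^-1) paired with F.m is F * mu paired with F^-1.(F.m) = m, which is
    F acting on the coaction of m. *)
Lemma twist_mul_comodule_map :
  @is_hcomodule_map2 _ (cotwist F Fi) _ _ _ (hmap coU) (hmap coV) (hmap coW)
    (twist_mul F coU coV m).
Proof.
split; first exact: twist_mul_bilin.
move=> u v /=.
pose bs (X : lmodType K) := (fun (y : fps X) (s : fps K^o) => (s : fps K) *: y).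
pose mF := conv D2 (@bs A) mu (hlift Fi).
pose P := conv D2 sc (hlift F) mF.
have bsl X : bilin (@bs X) by exact: scaler_bilin.
have mFl : linear mF by apply: conv_linear; lin.
have Pl : linear P by apply: conv_linear; lin.
have scFm : linear (conv rho2 sc (hlift F) (hlift (hmap2 m))) by apply: conv_linear; lin.
have scFiFm : linear (conv rho2 sc (hlift Fi) (conv rho2 sc (hlift F) (hlift (hmap2 m)))).
  by apply: conv_linear; lin.
transitivity (conv rho2 (@hpure K A W) P
    (conv rho2 sc (hlift F) (hlift (hmap2 m))) (hpure u v)); last first.
  rewrite {1}/conv sw_tcoact; [|by lin..].
  apply: eq_sw => a x; apply: eq_sw => b y.
  by rewrite [cotwist_mul _ _ _ _]cotwist_mul_conv twist_mul_conv.
have [hp1 hp2] := hpure_bilin A W.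
(* the leading F of F * mu * F^-1 moves out of the pairing, *)
rewrite -(conv_assoc cUV (b1 := sc) (b2 := @hpure K A W)); [|by lin..|]; last first.
  by move=> s y z; rewrite (linZ _ (hp2 _)).
rewrite twist_mul_conv linear_conv; last exact: (hcomod_linear cW).
apply: eq_sw => d z /=.
rewrite (linZ _ (hcomod_linear cW)); congr (_ *: _).
rewrite (hmap_coact_lift (coU := coU) (coV := coV)) //; try by [case: hU|case: hV|case: hW].
(* then the trailing F^-1 moves to the comodule factor, where it cancels F *)
rewrite -(conv_assoc cUV (b1 := @hpure K A W) (b2 := sc)); [|by lin..|]; last first.
  by move=> y s z'; rewrite (linZ _ (hp1 _)) (linZ _ (hp2 _)).
apply: eq_sw => d' z' /=; congr hpure.
rewrite (conv_assoc cUV (b3 := sc) (b4 := sc)); [|by lin..|]; last first.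
  by move=> s s' y; rewrite scalerA.
rewrite -[LHS](conv_counit cUV) //.
apply: eq_sw => d'' y; rewrite conv_inverse_lift //.
exact: (cochain_invl hF).
Qed.

End TwistedProduct.

Lemma conv3_pure (U V W X : lmodType K) (rU : fps U -> fps (tens A U))
    (rV : fps V -> fps (tens A V)) (rW : fps W -> fps (tens A W)) f
    (g : fps (tens (tens U V) W) -> fps X) u v w :
  linear rU -> linear rV -> linear rW -> linear f -> linear g ->
  conv (tcoact (tcoact rU rV) rW) sc f g (hpure (hpure u v) w) =
  \sw_(a, x <- rU u) \sw_(b, y <- rV v) \sw_(c, z <- rW w)
    ((f (hpure (hpure a b) c) : fps K) *: g (hpure (hpure x y) z)).
Proof.
move=> Ul Vl Wl fl gl; have t2l := tcoact_linear Ul Vl.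
rewrite /conv sw_tcoact; [|by lin..].
by rewrite sw_tcoact //; lin.
Qed.

(** The legs of a bilinear form G on A (x) A (x) A: the subscripts list the tensor
    factors entering each argument, a pair of digits standing for their product.
    The factor that does not occur is absorbed by the counit. *)
Definition leg12 (G : fps A -> fps A -> fps K^o) (a b c : fps A) : fps K^o :=
  (G a b : fps K) *: ep c.
Definition leg23 (G : fps A -> fps A -> fps K^o) (a b c : fps A) : fps K^o :=
  (ep a : fps K) *: G b c.
Definition leg1_23 (G : fps A -> fps A -> fps K^o) (a b c : fps A) : fps K^o := G a (b * c).
Definition leg12_3 (G : fps A -> fps A -> fps K^o) (a b c : fps A) : fps K^o := G (a * b) c.

Lemma leg12_trilin G : bilin G -> trilin (leg12 G).
Proof. by move=> bG; rewrite /leg12; split=> ? ?; lin. Qed.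
Lemma leg23_trilin G : bilin G -> trilin (leg23 G).
Proof. by move=> bG; rewrite /leg23; split=> ? ?; lin. Qed.
Lemma leg1_23_trilin G : bilin G -> trilin (leg1_23 G).
Proof. by move=> bG; rewrite /leg1_23; split=> ? ?; lin. Qed.
Lemma leg12_3_trilin G : bilin G -> trilin (leg12_3 G).
Proof. by move=> bG; rewrite /leg12_3; split=> ? ?; lin. Qed.

Let t12 := leg12_trilin bF.
Let t23 := leg23_trilin bF.
Let t1_23 := leg1_23_trilin bF.
Let t12_3 := leg12_3_trilin bF.
Let ti12 := leg12_trilin bFi.
Let ti12_3 := leg12_3_trilin bFi.
Let l12 := hlift3_linear t12.
Let l23 := hlift3_linear t23.
Let l1_23 := hlift3_linear t1_23.
Let l12_3 := hlift3_linear t12_3.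
Let li12 := hlift3_linear ti12.
Let li12_3 := hlift3_linear ti12_3.

Lemma sw_counitr (X : lmodType K) (g : fps A -> fps X) c : linear g ->
  \sw_(c1, c2 <- D c) ((ep c2 : fps K) *: g c1) = g c.
Proof.
move=> gl; move: c; apply: eq_linear_const; [by lin..|] => c.
rewrite hmap_const; last exact: cop_linear.
rewrite sw_const; last by lin.
rewrite -{2}(cop_counitr c) hconst_sum lin_sum //.
apply: eq_bigr => p _ /=; rewrite [ep _](@hmap_const K A K^o); last exact: counit_linear.
by rewrite hconstZ (linZ _ gl).
Qed.

(** The associator as a convolution product of functionals on A (x) A (x) A. *)
Definition phi_lift := conv D3 sc (hlift3 (leg23 F))
  (conv D3 sc (hlift3 (leg1_23 F)) (conv D3 sc (hlift3 (leg12_3 Fi)) (hlift3 (leg12 Fi)))).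

(** In the fourfold convolution each variable is split into four, one part of a and
    one of c being absorbed by a counit; the rest is exchanging sums. *)
Lemma cotwist_phi_conv a b c :
  cotwist_phi F Fi a b c = phi_lift (hpure (hpure a b) c).
Proof.
rewrite /phi_lift; set N2 := conv D3 sc (hlift3 (leg12_3 Fi)) _.
have N2l : linear N2 by apply: conv_linear; lin.
set N1 := conv D3 sc (hlift3 (leg1_23 F)) _.
have N1l : linear N1 by apply: conv_linear; lin.
have N2E x y z : N2 (hpure (hpure x y) z) =
    \sw_(a2, a3 <- D x) \sw_(b3, b4 <- D y) ((Fi (a2 * b3) z : fps K) *: Fi a3 b4).
  rewrite /N2 conv3_pure //; apply: eq_sw => a2 a3; apply: eq_sw => b3 b4.
  (* the fourth part of the third variable is absorbed by the counit in leg12 *)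
  rewrite -(sw_counitr (g := fun z => (Fi (a2 * b3) z : fps K) *: Fi a3 b4)); last by lin.
  apply: eq_sw => c3 c4; rewrite !hlift3_pure // /leg12_3 /leg12.
  rewrite !scalerA.
  change ((Fi (a2 * b3) c3 : fps K) * Fi a3 b4 * ep c4 =
          (ep c4 : fps K) * Fi (a2 * b3) c3 * Fi a3 b4).
  by rewrite mulrC mulrA.
have N1E x y z : N1 (hpure (hpure x y) z) =
    \sw_(a1, a' <- D x) \sw_(b2, b'' <- D y) \sw_(c2, c3 <- D z)
    ((F a1 (b2 * c2) : fps K) *: N2 (hpure (hpure a' b'') c3)).
  rewrite /N1 conv3_pure //; apply: eq_sw => ? ?; apply: eq_sw => ? ?.
  by apply: eq_sw => ? ?; rewrite hlift3_pure.
have -> : conv D3 sc (hlift3 (leg23 F)) N1 (hpure (hpure a b) c) =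
    \sw_(b1, b' <- D b) \sw_(c1, c' <- D c) ((F b1 c1 : fps K) *: N1 (hpure (hpure a b') c')).
  rewrite conv3_pure //.
  (* the first part of a is absorbed by the counit in leg23 *)
  rewrite -[RHS](conv_counit hA (m := fun a => \sw_(b1, b' <- D b) \sw_(c1, c' <- D c)
     ((F b1 c1 : fps K) *: N1 (hpure (hpure a b') c')))); last by lin.
  apply: eq_sw => a0 a'; rewrite scale_sw; apply: eq_sw => b1 b'.
  rewrite scale_sw; apply: eq_sw => c1 c'.
  by rewrite hlift3_pure // /leg23 !scalerA.
transitivity (\sw_(a1, a' <- D a) \sw_(a2, a3 <- D a') \sw_(b1, b' <- D b)
    \sw_(b2, b'' <- D b') \sw_(b3, b4 <- D b'') \sw_(c1, c' <- D c) \sw_(c2, c3 <- D c')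
    ((F b1 c1 * F a1 (b2 * c2) * Fi (a2 * b3) c3 * Fi a3 b4) : fps K^o)).
  by [].
(* Remaining: move the sums over the parts of a to the front, then those of b. *)
under [in RHS]eq_sw => b1 b' do under eq_sw => c1 c' do rewrite N1E scale_sw.
under [in RHS]eq_sw => b1 b' do rewrite sw_exchange.
rewrite [RHS]sw_exchange; apply: eq_sw => a1 a'.
transitivity (\sw_(b1, b' <- D b) \sw_(c1, c' <- D c) \sw_(b2, b'' <- D b')
   \sw_(c2, c3 <- D c') \sw_(a2, a3 <- D a')  \sw_(b3, b4 <- D b'')
     ((F b1 c1 * F a1 (b2 * c2) * Fi (a2 * b3) c3 * Fi a3 b4) : fps K^o)); last first.
  apply: eq_sw => b1 b'; apply: eq_sw => c1 c'.
  rewrite scale_sw; apply: eq_sw => b2 b''; rewrite scale_sw; apply: eq_sw => c2 c3.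
  rewrite N2E !scale_sw; apply: eq_sw => a2 a3; rewrite !scale_sw; apply: eq_sw => b3 b4.
  by rewrite !scalerA.
under [in RHS]eq_sw => b1 b' do under eq_sw => c1 c' do
  under eq_sw => b2 b'' do rewrite sw_exchange.
under [in RHS]eq_sw => b1 b' do under eq_sw => c1 c' do rewrite sw_exchange.
under [in RHS]eq_sw => b1 b' do rewrite sw_exchange.
rewrite [RHS]sw_exchange; apply: eq_sw => a2 a3; apply: eq_sw => b1 b'.
rewrite [RHS]sw_exchange; apply: eq_sw => b2 b''.
under [in RHS]eq_sw => c1 c' do rewrite sw_exchange.
by rewrite [RHS]sw_exchange.
Qed.

Lemma hcounit_mul (a b : fps A) : ep (a * b) = (ep a : fps K) * ep b.
Proof.
have sl (s : fps K^o) : linear (fun t : fps K^o => (s : fps K) *: t) by lin.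
apply: (@eq_bilin_const _ A A K^o (fun a b => ep (a * b)) (fun a b => (ep a : fps K) *: ep b));
  [by lin..|] => u v.
rewrite [hconst u * _]hmap2_const; last exact: mulr_bilin.
rewrite /hcounit !(@hmap_const K A K^o); try exact: (@counit_linear K A).
by rewrite counitM -hconstZ.
Qed.

Lemma conv_leg12_inv t : conv D3 sc (hlift3 (leg12 Fi)) (hlift3 (leg12 F)) t = ep3 t.
Proof.
have ep2l := hcounit_linear hA2.
move: t; apply: eq_linear_tens3 => [||a b c].
- by apply: conv_linear; lin.
- exact: tcounit_linear.
rewrite !tcounit_pure // conv3_pure; [|by lin..].
transitivity (\sw_(a1, a2 <- D a) \sw_(b1, b2 <- D b)
    (((Fi a1 b1 : fps K) *: F a2 b2 : fps K) *: ep c)).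
  apply: eq_sw => a1 a2; apply: eq_sw => b1 b2.
  rewrite -(conv_counit hA
    (m := fun c => ((Fi a1 b1 : fps K) *: F a2 b2 : fps K) *: ep c)); last by lin.
  apply: eq_sw => c1 c2; rewrite !hlift3_pure // /leg12 !scalerA.
  by congr (_ *: _); rewrite [LHS]mulrAC [RHS]mulrC.
under eq_sw => a1 a2 do rewrite -sw_scale.
by rewrite -sw_scale; congr (_ *: _); exact: (cochain_invl hF).
Qed.

(** F^-1 * F = counit, evaluated at a b and c: the coproduct is multiplicative. *)
Lemma conv_leg12_3_inv t : conv D3 sc (hlift3 (leg12_3 Fi)) (hlift3 (leg12_3 F)) t = ep3 t.
Proof.
have ep2l := hcounit_linear hA2.
move: t; apply: eq_linear_tens3 => [||a b c].
- by apply: conv_linear; lin.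
- exact: tcounit_linear.
rewrite !tcounit_pure // conv3_pure; [|by lin..].
transitivity (ep (a * b) * ep c : fps K); last by rewrite hcounit_mul.
rewrite -[RHS](cochain_invl hF).
have cl := @cop_linear K A.
rewrite [hmap _ (a * b)](hmap_coact_mul cl cl cl (mulr_bilin A) (@copM K A)).
have bG : bilin (fun d1 d2 => \sw_(c1, c2 <- D c) ((Fi d1 c1 : fps K) *: F d2 c2)) by lin.
rewrite [RHS](sw_sw _ _ bG); apply: eq_sw => a1 a2; rewrite (sw_sw _ _ bG).
apply: eq_sw => b1 b2; rewrite (sw_pure _ _ bG); apply: eq_sw => c1 c2.
by rewrite !hlift3_pure.
Qed.

(** * Associativity up to the associator *)

Section Associativity.
Variables (U V W UV VW N : lmodType K).
Variables (coU : U -> tens A U) (coV : V -> tens A V) (coW : W -> tens A W)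
  (coUV : UV -> tens A UV) (coVW : VW -> tens A VW).
Hypotheses (hU : is_comodule coU) (hV : is_comodule coV) (hW : is_comodule coW)
  (hUV : is_comodule coUV) (hVW : is_comodule coVW).
Variables (m1 : U -> V -> UV) (m2 : UV -> W -> N) (m3 : V -> W -> VW) (m4 : U -> VW -> N).
Hypotheses (b1 : bilin m1) (b2 : bilin m2) (b3 : bilin m3) (b4 : bilin m4).
Hypothesis com1 : forall u v, coUV (m1 u v) =
    \csw_(a, x <- coU u) \csw_(b, y <- coV v) tpure (a * b) (m1 x y).
Hypothesis com3 : forall u v, coVW (m3 u v) =
    \csw_(a, x <- coV u) \csw_(b, y <- coW v) tpure (a * b) (m3 x y).
Hypothesis mA : forall u v w, m4 u (m3 v w) = m2 (m1 u v) w.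

Let lU := coact_linear hU.
Let lV := coact_linear hV.
Let lW := coact_linear hW.
Let lUV := coact_linear hUV.
Let lVW := coact_linear hVW.
Let cU := hcomod_classical hU.
Let cV := hcomod_classical hV.
Let cW := hcomod_classical hW.
Let cUV := hcomod_classical hUV.
Let c3 := tcomod (tcomod cU cV) cW.
Let B1 := hmap2_bilin b1.
Let B2 := hmap2_bilin b2.
Let B4 := hmap2_bilin b4.
Let m123 (u : fps U) (v : fps V) (w : fps W) := hmap2 m2 (hmap2 m1 u v) w.
Local Notation rho3 := (tcoact (tcoact (hmap coU) (hmap coV)) (hmap coW)).

Lemma hmap2_assoc u v w : hmap2 m4 u (hmap2 m3 v w) = m123 u v w.
Proof.
have [l1 r1] := b4; have [l2 r2] := b2.
apply: hmap2A => [x|x|x|x|a b c].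
- exact: (linD (r2 x)).
- exact: (lin0 (r2 x)).
- exact: (linD (l1 x)).
- exact: (lin0 (l1 x)).
- exact: mA.
Qed.

Let t123 : trilin m123.
Proof. by rewrite /m123; split=> ? ?; lin. Qed.
Let l123 := hlift3_linear t123.

Let conv12_3 := conv rho3 sc (hlift3 (leg12_3 F)) (hlift3 m123).
Let conv1_23 := conv rho3 sc (hlift3 (leg1_23 F)) (hlift3 m123).
Let conv12_3l : linear conv12_3.
Proof. by apply: conv_linear; lin. Qed.
Let conv1_23l : linear conv1_23.
Proof. by apply: conv_linear; lin. Qed.

(** F.m3 contributes F_23; then m3 being covariant, the outer F becomes F_1,23. *)
Lemma twist_assoc_left u v w :
  twist_mul F coU coVW m4 u (twist_mul F coV coW m3 v w) =
  conv rho3 sc (hlift3 (leg23 F)) conv1_23 (hpure (hpure u v) w).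
Proof.
rewrite conv3_pure; [|by lin..].
rewrite {2}/twist_mul linear_sw; last by case: (twist_mul_bilin hU hVW b4).
rewrite -[LHS](conv_counit cU (m := fun u => \sw_(b, y <- hmap coV v)
   twist_mul F coU coVW m4 u
     (\sw_(c, z <- hmap coW w) ((F b c : fps K) *: hmap2 m3 y z)))); last first.
  by have bt := twist_mul_bilin hU hVW b4; lin.
apply: eq_sw => a x; rewrite scale_sw; apply: eq_sw => b y.
have tl := proj1 (twist_mul_bilin hU hVW b4) x.
rewrite linear_sw // scale_sw; apply: eq_sw => c z.
rewrite (linZ _ tl) hlift3_pure // scalerA; congr (_ *: _).
rewrite /conv1_23 conv3_pure; [|by lin..].
apply: eq_sw => a' x'.
rewrite (hmap_coact_mul lV lW lVW b3 com3) sw_sw; last by lin.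
apply: eq_sw => b' y'; rewrite sw_sw; last by lin.
apply: eq_sw => c' z'; rewrite sw_pure; last by lin.
by rewrite !hlift3_pure // hmap2_assoc.
Qed.

Lemma twist_assoc_right u v w :
  twist_mul F coUV coW m2 (twist_mul F coU coV m1 u v) w =
  conv rho3 sc (hlift3 (leg12 F)) conv12_3 (hpure (hpure u v) w).
Proof.
rewrite conv3_pure; [|by lin..].
have bt := twist_mul_bilin hUV hW b2; have tl w' := proj2 bt w'.
rewrite {2}/twist_mul (linear_sw _ _ (tl w)); apply: eq_sw => a x.
rewrite (linear_sw _ _ (tl w)); apply: eq_sw => b y.
rewrite (linZ _ (tl w)).
transitivity ((F a b : fps K) *: conv12_3 (hpure (hpure x y) w)); last first.
  rewrite -(conv_counit cW
    (m := fun w => (F a b : fps K) *: conv12_3 (hpure (hpure x y) w))); last by lin.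
  by apply: eq_sw => c z; rewrite hlift3_pure // /leg12 !scalerA mulrC.
congr (_ *: _); rewrite /conv12_3 conv3_pure; [|by lin..].
rewrite /twist_mul (hmap_coact_mul lU lV lUV b1 com1) sw_sw; last by lin.
apply: eq_sw => a' x'; rewrite sw_sw; last by lin.
apply: eq_sw => b' y'; rewrite sw_pure; last by lin.
by apply: eq_sw => c' z'; rewrite !hlift3_pure.
Qed.

(** Acting by phi on the right-hand product gives
    F_23.F_1,23.F^-1_12,3.F^-1_12.F_12.F_12,3.m, which collapses from the middle. *)
Lemma twist_mul_assoc u v w :
  twist_mul F coU coVW m4 u (twist_mul F coV coW m3 v w) =
  \sw_(a, x <- hmap coU u) \sw_(b, y <- hmap coV v) \sw_(c, z <- hmap coW w)
    (cotwist_phi F Fi a b c *: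
       twist_mul F coUV coW m2 (twist_mul F coU coV m1 x y) z).
Proof.
have ss (X : lmodType K) (s s' : fps K^o) (y : fps X) :
  (s : fps K) *: ((s' : fps K) *: y) = (((s : fps K) *: s') : fps K) *: y.
  by rewrite scalerA.
rewrite twist_assoc_left; set R := (RHS).
(* S1, S2 are the right-hand factors of the associator; M, M1, M2 arise when the
   factors F_12, F^-1_12 and F^-1_12,3 have acted. *)
pose S1 := conv D3 sc (hlift3 (leg12_3 Fi)) (hlift3 (leg12 Fi)).
pose S2 := conv D3 sc (hlift3 (leg1_23 F)) S1.
have S1l : linear S1 by apply: conv_linear; lin.
have S2l : linear S2 by apply: conv_linear; lin.
have pl : linear phi_lift by apply: conv_linear; lin.
pose M := conv rho3 sc (hlift3 (leg12 F)) conv12_3.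
have Ml : linear M by apply: conv_linear; lin.
pose M1 := conv rho3 sc (hlift3 (leg12 Fi)) M.
have M1l : linear M1 by apply: conv_linear; lin.
pose M2 := conv rho3 sc (hlift3 (leg12_3 Fi)) M1.
have M2l : linear M2 by apply: conv_linear; lin.
have -> : R = conv rho3 sc phi_lift M (hpure (hpure u v) w).
  rewrite conv3_pure; [|by lin..].
  apply: eq_sw => a x; apply: eq_sw => b y; apply: eq_sw => c z.
  by rewrite cotwist_phi_conv twist_assoc_right.
have cancel1 t : M1 t = conv12_3 t.
  rewrite /M1 (conv_assoc c3 (b3 := sc) (b4 := sc)); [|by lin..|by move=> *; exact: ss].
  rewrite -[RHS](conv_counit c3); last by lin.
  by apply: eq_sw => d y; rewrite conv_leg12_inv.
have cancel2 t : M2 t = hlift3 m123 t.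
  transitivity (conv rho3 sc (hlift3 (leg12_3 Fi)) conv12_3 t).
    by apply: eq_sw => d y; rewrite cancel1.
  rewrite (conv_assoc c3 (b3 := sc) (b4 := sc)); [|by lin..|by move=> *; exact: ss].
  rewrite -[RHS](conv_counit c3); last by lin.
  by apply: eq_sw => d y; rewrite conv_leg12_3_inv.
rewrite -(conv_assoc c3 (b1 := sc) (b2 := sc)); [|by lin..|by move=> *; exact: ss].
apply: eq_sw => d t; congr (_ *: _).
rewrite -(conv_assoc c3 (b1 := sc) (b2 := sc)); [|by lin..|by move=> *; exact: ss].
apply: eq_sw => d' t'; congr (_ *: _).
rewrite -(conv_assoc c3 (b1 := sc) (b2 := sc)); [|by lin..|by move=> *; exact: ss].
by rewrite [RHS]cancel2.
Qed.

End Associativity.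

(** * Units and differentials *)

Lemma twist_unitl (U V : lmodType K) (coU : U -> tens A U) (coV : V -> tens A V)
    (m : U -> V -> V) (one : U) :
  is_comodule coU -> is_comodule coV -> bilin m -> coU one = tpure 1 one ->
  (forall v, m one v = v) -> forall v, twist_mul F coU coV m (hconst one) v = v.
Proof.
move=> hU hV bm co1 m1 v.
have cU := hcomod_classical hU; have cV := hcomod_classical hV.
have bM := hmap2_bilin bm.
rewrite /twist_mul hmap_const; last exact: coact_linear hU.
rewrite co1 -hpure_const sw_pure; last by lin.
rewrite -[RHS](hcomod_counit cV); apply: eq_sw => b y.
rewrite (cochain_unitl hF); congr (_ *: _).
move: y; apply: eq_linear_const; [by lin..|] => y.
by rewrite hmap2_const // m1.
Qed.

Lemma twist_unitr (U V : lmodType K) (coU : U -> tens A U) (coV : V -> tens A V)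
    (m : V -> U -> V) (one : U) :
  is_comodule coU -> is_comodule coV -> bilin m -> coU one = tpure 1 one ->
  (forall v, m v one = v) -> forall v, twist_mul F coV coU m v (hconst one) = v.
Proof.
move=> hU hV bm co1 m1 v.
have cU := hcomod_classical hU; have cV := hcomod_classical hV.
have bM := hmap2_bilin bm.
rewrite /twist_mul hmap_const; last exact: coact_linear hU.
rewrite -[RHS](hcomod_counit cV); apply: eq_sw => b y.
rewrite co1 -hpure_const sw_pure; last by lin.
rewrite (cochain_unitr hF); congr (_ *: _).
move: y; apply: eq_linear_const; [by lin..|] => y.
by rewrite hmap2_const // m1.
Qed.

Section Differential.
Variables (V V' : lmodType K) (coV : V -> tens A V) (coV' : V' -> tens A V') (d : V -> V').
Hypotheses (hV : is_comodule coV) (hV' : is_comodule coV') (dl : linear d).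
Hypothesis cod : forall v, coV' (d v) = \csw_(a, x <- coV v) tpure a (d x).
Let cV := hcomod_classical hV.
Let cV' := hcomod_classical hV'.
Let hdl := hmap_linear dl.

Lemma hmap_comodule_map v :
  hmap coV' (hmap d v) = \sw_(a, x <- hmap coV v) hpure a (hmap d x).
Proof.
move: v; apply: eq_linear_const; [by lin..|] => v.
rewrite (hmap_const _ dl) (hmap_const _ (coact_linear hV)) (hmap_const _ (coact_linear hV')).
rewrite cod hconst_sum sw_const; last by lin.
by apply: eq_bigr => p _; rewrite (hmap_const _ dl) hpure_const.
Qed.

Section Products.
Variables (U W : lmodType K) (coU : U -> tens A U) (hU : is_comodule coU).
Let cU := hcomod_classical hU.

Lemma twist_mul_dl (m : V' -> U -> W) v u : bilin m ->
  twist_mul F coV' coU m (hmap d v) u =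
  \sw_(a, x <- hmap coV v) \sw_(b, y <- hmap coU u) ((F a b : fps K) *: hmap2 m (hmap d x) y).
Proof.
move=> /hmap2_bilin bM; rewrite /twist_mul hmap_comodule_map sw_sw; last by lin.
by apply: eq_sw => a x; rewrite sw_pure //; lin.
Qed.

Lemma twist_mul_dr (m : U -> V' -> W) u v : bilin m ->
  twist_mul F coU coV' m u (hmap d v) =
  \sw_(a, x <- hmap coU u) \sw_(b, y <- hmap coV v) ((F a b : fps K) *: hmap2 m x (hmap d y)).
Proof.
move=> /hmap2_bilin bM; rewrite /twist_mul; apply: eq_sw => a x.
rewrite hmap_comodule_map sw_sw; last by lin.
by apply: eq_sw => b y; rewrite sw_pure //; lin.
Qed.

(** If w is the sum of the b dx over a tensor t0, then w is the sum of the twisted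
    products over F^-1.t0. *)
Lemma twist_surj (m : U -> V' -> W) : bilin m ->
  (forall w, exists t : tens U V, w = \csw_(b, x <- t) m b (d x)) ->
  forall w, exists t : fps (tens U V),
    w = \sw_(b, x <- t) twist_mul F coU coV' m b (hmap d x).
Proof.
move=> bm /choice[tau tauE] w.
have bM := hmap2_bilin bm; have bT := twist_mul_bilin hU hV' bm.
have cUV := tcomod cU cV.
pose rho := tcoact (hmap coU) (hmap coV).
(* t0 expresses w in the undeformed calculus, one power of h at a time; M and L
   evaluate tensors by the undeformed and by the twisted product. *)
pose t0 := Fps (fun n => tau (w n)).
pose M := hlift (fun b x => hmap2 m b (hmap d x)).
pose L := hlift (fun b x => twist_mul F coU coV' m b (hmap d x)).
have Ml : linear M by apply: hlift_linear; lin.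
have Ll : linear L by apply: hlift_linear; lin.
have ME : M t0 = w.
  apply/fpsP => n; rewrite /M /hlift /hsweedler /=.
  rewrite (eq_bigr (fun i : 'I_n.+1 => hconst (w i) (n - i)%N)) => [|i _].
    rewrite big_ord_recr /= subnn big1 ?add0r // => i _.
    by rewrite /= -(subnSK (ltn_ord i)).
  rewrite [in RHS](tauE (w i)) hconst_sum; congr (coefh _ _).
  by apply: eq_bigr => p _; rewrite (hmap_const _ dl) hmap2_const.
have LE s : L s = conv rho sc (hlift F) M s.
  move: s; apply: eq_linear_tens => [||u v]; [by lin|by apply: conv_linear; lin|].
  rewrite /L hlift_pure; last by lin.
  rewrite twist_mul_dr // /conv sw_tcoact; [|by lin..].
  apply: eq_sw => a x; apply: eq_sw => b y.
  by rewrite /M !hlift_pure //; lin.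
exists (conv rho sc (hlift Fi) (fun s => s) t0).
rewrite -[RHS]/(L _) linear_conv // -ME.
transitivity (conv rho sc (hlift Fi) (conv rho sc (hlift F) M) t0).
  rewrite (conv_assoc cUV (b3 := sc) (b4 := sc)); [|by lin..|by move=> *; rewrite scalerA].
  rewrite -[LHS](conv_counit cUV) //; apply: eq_sw => a s.
  by rewrite conv_inverse_lift //; exact: (cochain_invl hF).
by apply: eq_sw => a s; rewrite (linZ _ Ll) LE.
Qed.

End Products.
End Differential.
End Cotwisting.

Lemma hconst_signr (K : comNzRingType) i : hconst ((-1) ^+ i : K) = (-1) ^+ i :> fps K.
Proof.
elim: i => [|i IH]; first by [].
rewrite !exprS -IH; apply/fpsP => -[|n].
  by rewrite /= big_ord1.
rewrite !mulN1r /=; by rewrite oppr0.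
Qed.

(** * The twisted algebra and its calculus *)

Section TwistedCalculus.
Variables (K : fieldType) (A : comHopf K) (F Fi : fps A -> fps A -> fps K).
Hypothesis hF : is_cochain F Fi.
Variables (B : comAlgType K) (coact : B -> tens A B) (hB : is_comodule_algebra coact).

Lemma mulrB_bilin : bilin (@GRing.mul B).
Proof. by split=> a c x y; [rewrite mulrDr scalerAr|rewrite mulrDl scalerAl]. Qed.

Lemma twist_quasialgebra :
  @is_quasialgebra _ (cotwist F Fi) B (hmap coact) 1 (twist_mul F coact coact *%R).
Proof.
have [hc hm h1] := hB; have bm := mulrB_bilin.
split.
- exact: is_hcomodule_classical.
- exact: (twist_mul_comodule_map hF).
- by rewrite [hmap _ _]hmap_const ?h1 -?hpure_const //; apply: coact_linear hc.
- by apply: (twist_unitl hF) => // v; rewrite mul1r.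
- by apply: (twist_unitr hF) => // v; rewrite mulr1.
- by move=> a b c; apply: (twist_mul_assoc hF) => // u v w; rewrite mulrA.
Qed.

Variables (P : nat -> lmodType K)
  (coactO : forall k, graded B P k -> tens A (graded B P k))
  (wedge : forall i j k, (i + j)%N = k -> graded B P i -> graded B P j -> graded B P k)
  (dO : forall k, graded B P k -> graded B P k.+1).
Hypothesis hO : is_classical_calculus coact coactO wedge dO.

Lemma twist_quasi_calculus :
  @is_quasi_calculus _ (cotwist F Fi) B (hmap coact) 1
    (twist_mul F coact coact *%R) P
    (fun k => hmap (@coactO k))
    (fun i j k ijk => twist_mul F (@coactO i) (@coactO j) (@wedge i j k ijk))
    (fun k => hmap (@dO k)).
Proof.
have hc := ccal_comodule hO; have dl := ccal_d_linear hO; have dc := ccal_d_coact hO.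
have bw := ccal_bilin hO; have co0 : @coactO 0%N = coact by apply: funext; exact: ccal_coact0 hO.
have one1 : @coactO 0%N (1 : B) = tpure 1 (1 : B) by rewrite co0 (coalg1 hB).
split.
- by move=> b; rewrite co0.
- move=> e a b; rewrite co0; congr (twist_mul F _ _ _ _ _).
  by apply: funext => x; apply: funext => y; exact: ccal_wedge0 hO _ _ _.
- by move=> k; exact: is_hcomodule_classical.
- move=> i j k e; apply: (twist_mul_comodule_map hF) => //.
  exact: ccal_coactM hO _ _ _ _.
- by move=> k e u; apply: (twist_unitl hF) => //; exact: ccal_unitl hO _ _.
- by move=> k e u; apply: (twist_unitr hF) => //; exact: ccal_unitr hO _ _.
- move=> i j k ij jk n e1 e2 e3 e4 u v w; apply: (twist_mul_assoc hF) => //.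
  + exact: ccal_coactM hO _ _ _ _.
  + exact: ccal_coactM hO _ _ _ _.
  + exact: ccal_assoc hO _ _ _ _ _ _ _ _ _ _.
- move=> k; split; first exact: hmap_linear.
  by move=> v; apply: hmap_comodule_map.
- move=> k u; apply/fpsP => n; exact: ccal_dd hO _ _.
- move=> i j k e e1 e2 u v.
  have hdl m := hmap_linear (dl m).
  rewrite (twist_mul_dl hF (hc _) (hc _)) // (twist_mul_dr hF (hc _) (hc _)) //.
  rewrite /twist_mul linear_sw // scale_sw -sw_add; apply: eq_sw => a x.
  rewrite linear_sw // scale_sw -sw_add; apply: eq_sw => b y.
  rewrite (linZ _ (hdl _)) scalerA [_ ^+ _ * _]mulrC -scalerA -scalerDr; congr (_ *: _).
  have hdk := hdl k; have hdi := hdl i; have hdj := hdl j.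
  have bM := hmap2_bilin (bw _ _ _ e); have bM1 := hmap2_bilin (bw _ _ _ e1).
  have bM2 := hmap2_bilin (bw _ _ _ e2).
  move: x y; apply: eq_bilin_const => [||x y].
  + by lin.
  + by lin.
  rewrite hmap2_const // !hmap_const // !hmap2_const // -hconst_signr -hconstZ -hconstD.
  by rewrite (ccal_leibniz hO e e1 e2).
- move=> k e u; apply: (twist_surj hF (hc k) (hc k.+1) (dl k) _ (hc 0%N) (bw _ _ _ e)).
  + exact: dc.
  + by move=> w; exact: (ccal_surj hO e w).
Qed.

End TwistedCalculus.

Unset Implicit Arguments.
Set Strict Implicit.
Set Printing Implicit Defensive.

Theorem theorem13 (R : realType)
  (* the group G, its coordinate Hopf algebra A = C(G) and its Lie algebra *)
  (n : nat) (G : 'M[R[i]]_n -> Prop) (hG : is_connected_algebraic_group G)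
  (A : comHopf R[i]) (ev : A -> 'M[R[i]]_n -> R[i])
  (hA : is_coordinate_hopf G ev)
  (hsimple : lie_simple A)
  (r : nat) (c : 'M[int]_r) (d : 'I_r -> nat) (hc : is_cartan c d)
  (h e f : 'I_r -> A -> R[i]) (hchev : is_chevalley c h e f)
  (* the cochain F and the isomorphism of C_q(G) with H^F *)
  (F Fi : fps A -> fps A -> fps R[i]) (hF : is_cochain F Fi)
  (theta : fps A -> seq (dj_gen r) -> fps R[i])
  (htheta : @is_quantum_group_iso _ _ c d A h e f (cotwist F Fi) theta)
  (* the G-manifold M and its classical differential calculus *)
  (B : comAlgType R[i]) (coact : B -> tens A B)
  (hB : is_comodule_algebra coact)
  (P : nat -> lmodType R[i])
  (coactO : forall k, graded B P k -> tens A (graded B P k))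
  (wedge : forall i j k, (i + j)%N = k ->
     graded B P i -> graded B P j -> graded B P k)
  (dO : forall k, graded B P k -> graded B P k.+1)
  (hO : is_classical_calculus coact coactO wedge dO) :
  @is_quasialgebra _ (cotwist F Fi) B (hmap coact) 1
    (twist_mul F coact coact *%R) /\
  @is_quasi_calculus _ (cotwist F Fi) B (hmap coact) 1
    (twist_mul F coact coact *%R) P
    (fun k => hmap (coactO k))
    (fun i j k ijk => twist_mul F (coactO i) (coactO j) (wedge i j k ijk))
    (fun k => hmap (dO k)).
Proof.
split; [exact: twist_quasialgebra|exact: twist_quasi_calculus].
Qed.
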